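(* Let $\Phi$ be a modular family on the unit circle that is uniformly doubling and has the $A_\infty$ property. Let $\mathcal{F}$ be a family of pairs $(f,g)$ of functions on the unit circle, with $f$ nonnegative and lower semicontinuous, such that if $(f,g)\in\mathcal{F}$ then $(\alpha f,\alpha g)\in\mathcal{F}$ for any $\alpha>0$. Suppose that the following good-$\lambda$ inequality holds between any $f$ and $g$ such that $(f,g)\in\mathcal{F}$: there is a $\beta>0$ such that for each sufficiently small $\delta>0$ there exists a $\gamma>0$ (with $\beta$ and $\gamma$ not depending on the pair $(f,g)$) such that for each $\lambda>0$ and each basic interval $I$ of the level set $\{x: f(x)>\lambda\}$ one has \[ m(\{x\in I: f(x)>\beta\lambda \text{ and } g(x)<\gamma\lambda\})<\delta\, m(I). \] Then for each $A>0$ there is a $B>0$ such that, for every $(f,g)\in\mathcal{F}$, if $\rho_\Phi(f)$ is finite then $\|f\|_{\Phi,(A)}\le\|g\|_{\Phi,(B)}$. Also, if $\rho_\Phi(g)\le B$, then $\rho_\Phi(f)\le A$ or $\rho_\Phi(f)=\infty$.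
   Context: The unit circle is parametrized by $x\in[0,2\pi)$ and $m$ (also $dx$) denotes arc length. ''Interval'' means an arc of the unit circle. All functions are assumed measurable as needed for the integrals to make sense. Modular family: for each $x$ in the unit circle a continuous increasing function $\Phi_x:[0,\infty)\to[0,\infty)$ with $\Phi_x(0)=0$ and $\Phi_x(t)\to\infty$ as $t\to\infty$; the collection is denoted $\Phi$. Uniformly doubling: there is a constant $C'$ with $\Phi_x(2\lambda)\le C'\Phi_x(\lambda)$ for all $x$ and all $\lambda$. Modular and modified norm: $\rho_\Phi(f)=\int_0^{2\pi}\Phi_x(|f(x)|)\,dx$, and for $a>0$, $\|f\|_{\Phi,(a)}=\inf\{\lambda>0:\int_0^{2\pi}\Phi_x(|f(x)|/\lambda)\,dx<a\}$. For $\lambda>0$, $\mu_\lambda$ is the measure $\Phi_x(\lambda)\,dx$ on the circle. Basic intervals of an open subset of the circle: the disjoint open arcs into which it decomposes uniquely. $A_\infty$ property: for each $B>0$ there are constants $\epsilon,\delta$ with $0<\epsilon,\delta<1$ such that for every $\lambda>0$, every interval $I$ with $\mu_\lambda(I)\le B$ and every $E\subset I$ with $m(E)<\delta\, m(I)$, one has $\mu_\lambda(E)<\epsilon\,\mu_\lambda(I)$. *)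

(* Defs.v *)
From HB Require Import structures.
From mathcomp Require Import all_boot all_order all_algebra.
From mathcomp Require Import all_classical all_reals all_analysis.

Set Implicit Arguments.
Unset Strict Implicit.
Unset Printing Implicit Defensive.

Import Order.TTheory GRing.Theory Num.Theory.
Import numFieldNormedType.Exports.

Local Open Scope classical_set_scope.
Local Open Scope ring_scope.

(* The unit circle is represented by its parameter set [0, 2 pi[; a function on
   the circle is a function R -> R of which only the values on that set are ever
   used. The topology and the arcs are those of the circle, transported along
   wrap, the quotient map R -> R / 2 pi Z read in [0, 2 pi[. *)
Section circle.
Variable R : realType.

Definition circle : set R := `[0, 2 * pi[.

Definition wrap (t : R) : R := t - 2 * pi * (Num.floor (t / (2 * pi)))%:~R.

(* J may be longer than 2 pi, so the whole circle is an arc *)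
Definition arc (I : set R) : Prop :=
  exists2 J : set R, is_interval J & I = wrap @` J.

Definition open_arc (I : set R) : Prop :=
  exists J : set R, [/\ open J, is_interval J, J !=set0 & I = wrap @` J].

Definition arc_decomposition (U : set R) (D : set (set R)) : Prop :=
  [/\ forall I, D I -> open_arc I, trivIset D id & \bigcup_(I in D) I = U].

(* D is determined by U, hence the quantification over D is immaterial *)
Definition basic_interval (U I : set R) : Prop :=
  exists2 D, arc_decomposition U D & D I.

Definition circle_lower_semicontinuous (f : R -> R) : Prop :=
  lower_semicontinuous (fun t : R => (f (wrap t))%:E).

(* R with the Lebesgue (not only Borel) sigma-algebra *)
Definition lebR := caratheodory_type ((@wlength R idfun)^*)%mu.

Definition arclength : {measure set lebR -> \bar R} :=
  @completed_lebesgue_measure R.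

Definition circle_measurable (f : R -> R) : Prop :=
  measurable_fun (circle : set lebR) (f : lebR -> R).

End circle.

Arguments circle {R}.
Arguments wrap {R}.
Arguments arclength {R}.

Section modular.
Variable R : realType.
Implicit Types (Phi : R -> R -> R) (f : R -> R).

Definition modular_family Phi : Prop :=
  (forall x, circle x ->
     [/\ Phi x 0 = 0,
         forall t, 0 <= t -> 0 <= Phi x t,
         forall s t, 0 <= s -> s <= t -> Phi x s <= Phi x t,
         {within `[0, +oo[, continuous (Phi x)}
       & Phi x t @[t --> +oo] --> +oo]) /\
  (forall t, 0 <= t -> circle_measurable (Phi ^~ t)).

Definition uniformly_doubling Phi : Prop :=
  exists C : R, forall x t, circle x -> 0 <= t ->
    Phi x (2 * t) <= C * Phi x t.

Definition modular Phi f : \bar R :=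
  (\int[arclength]_(x in circle) (Phi x `|f x|)%:E)%E.

(* infinite when no l qualifies, the infimum being taken in \bar R *)
Definition modified_norm Phi (a : R) f : \bar R :=
  ereal_inf [set l%:E | l in
    [set l : R | 0 < l /\ (modular Phi (fun x => f x / l)%R < a%:E)%E]].

Definition level_measure Phi (l : R) (E : set R) : \bar R :=
  (\int[arclength]_(x in E) (Phi x l)%:E)%E.

Definition A_infty Phi : Prop :=
  forall B : R, 0 < B ->
  exists eps delta : R, [/\ 0 < eps < 1, 0 < delta < 1 &
    forall (l : R) (I : set R), 0 < l -> arc I ->
      (level_measure Phi l I <= B%:E)%E ->
    forall E : set (lebR R), measurable E -> E `<=` I ->
      (arclength E < delta%:E * arclength I)%E ->
      (level_measure Phi l E < eps%:E * level_measure Phi l I)%E].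

Definition good_lambda (F : set ((R -> R) * (R -> R))) : Prop :=
  exists2 beta : R, 0 < beta &
  exists2 delta0 : R, 0 < delta0 &
  forall delta : R, 0 < delta -> delta < delta0 ->
  exists2 gamma : R, 0 < gamma &
  forall f g : R -> R, F (f, g) ->
  forall (l : R) (I : set R), 0 < l ->
    basic_interval [set x | circle x /\ l < f x] I ->
    (arclength [set x | [/\ I x, beta * l < f x & g x < gamma * l]%R]
       < delta%:E * arclength I)%E.

End modular.

(* Main.v *)
Require Import Defs.
From HB Require Import structures.
From mathcomp Require Import all_boot all_order all_algebra.
From mathcomp Require Import all_classical all_reals all_analysis.
From mathcomp Require Import measurable_realfun ring lra.
(* all_boot also defines a [wrap]. *)
Import Defs.

(** The layers of Phi cannot be summed level by level, because the increments of
  the measures [mu_l] between two levels need not have the A_infty property and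
  Phi may grow slowly. Instead one climbs, from a basic interval I of
  [f > l], to the first level [l'] at which [mu_l'(I) >= r mu_l(I)]. By doubling,
  the part of I where [f <= l'] contributes at most a constant times [mu_l(I)].
  On the rest, the good-lambda inequality applied just below [l'] disposes of the
  points where g is small; on the remaining set H, g is at least of size [l'].
  Either [mu] at least doubles on H between the two levels, so that the increment
  is paid by g, or [mu_l'(H)] is a small part of [mu_l'(I)]. The A_infty property
  in both its quantitative forms (small length forces small mass, small mass
  forces small length) then makes [mu_l(H)], hence [mu_l'(H)], a small
  part of [mu_l(I)]. This yields [rho(f) <= C rho(g)] as soon as [rho(f)] is
  smaller than some constant M, so that A_infty is only needed for B = 1. The
  smallness of [rho(f)] is removed by scaling: among the [f / 2^k], the first
  one with modular at most [C' A] has modular larger than A unless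
  [rho(f) <= A].

  Both quantitative forms are obtained from the A_infty property by iterating a
  stopping-time selection on finite unions of dyadic subarcs, and by outer
  regularity of the Lebesgue measure. *)

Set Implicit Arguments.
Unset Strict Implicit.
Unset Printing Implicit Defensive.

Import Order.TTheory GRing.Theory Num.Theory.
Import numFieldNormedType.Exports.

Local Open Scope classical_set_scope.
Local Open Scope ring_scope.

(** * Arc length and half-open arcs *)

Section arclength_theory.
Variable R : realType.
Implicit Types (a b x t l : R) (A E U : set R).

Lemma borel_lebR A : measurable (A : set (measurableTypeR R)) ->
  measurable (A : set (lebR R)).
Proof. exact: sub_caratheodory. Qed.

Lemma open_lebR A : open A -> measurable (A : set (lebR R)).
Proof. by move=> oA; apply: borel_lebR; exact: open_measurable. Qed.

Lemma itv_lebR (i : interval R) : measurable ([set` i] : set (lebR R)).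
Proof. by apply: borel_lebR; exact: measurable_itv. Qed.

Lemma circle_lebR : measurable (circle : set (lebR R)).
Proof. exact: itv_lebR. Qed.

Lemma arclengthE A : arclength A = lebesgue_measure A :> \bar R.
Proof. by []. Qed.

Lemma arclength_itv a b : a <= b -> arclength `[a, b[%classic = (b - a)%:E.
Proof.
move=> ab; rewrite arclengthE lebesgue_measure_itv/= lte_fin.
by case: ltgtP ab => // -> _; rewrite subrr.
Qed.

Lemma arclength_set1 x : arclength [set x] = 0%E :> \bar R.
Proof. by rewrite arclengthE lebesgue_measure_set1. Qed.

Lemma arclength_outer E e : 0 < e ->
  exists U, [/\ open U, E `<=` U & (arclength U <= arclength E + e%:E)%E].
Proof. by move=> e0; exact: outer_measure_open_le. Qed.

Let twopi_gt0 : 0 < 2 * pi :> R.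
Proof. by rewrite mulr_gt0// pi_gt0. Qed.

Lemma wrapD t (k : int) : wrap (t + 2 * pi * k%:~R) = wrap t.
Proof.
rewrite /wrap; have -> : (t + 2 * pi * k%:~R) / (2 * pi) = t / (2 * pi) + k%:~R.
  by rewrite mulrDl [_ * k%:~R]mulrC -mulrA mulfV ?mulr1// gt_eqF.
rewrite floorDrz ?intr_int// intrKfloor intrD; move: (Num.floor _)%:~R => z.
lra.
Qed.

Lemma wrapE t : exists k : int, wrap t = t + 2 * pi * k%:~R.
Proof. by exists (- Num.floor (t / (2 * pi))); rewrite intrN mulrN. Qed.

Lemma circle_wrap t : circle (wrap t).
Proof.
rewrite /circle/wrap/= in_itv/=; have := floor_itv (t / (2 * pi)).
rewrite intrD ler_pdivlMr// ltr_pdivrMr//.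
by move=> /andP[]; set z := (_%:~R); rewrite mulrDl mul1r !(mulrC z) => *; apply/andP; split; lra.
Qed.

Lemma wrap_id x : circle x -> wrap x = x.
Proof.
rewrite /circle/wrap/= in_itv/= => /andP[x0 x1].
rewrite (_ : Num.floor _ = 0) ?mulr0 ?subr0//; apply: floor_def.
by rewrite add0r ler_pdivlMr// ltr_pdivrMr// mul0r mul1r x0.
Qed.

Lemma wrapE_circle t (k : int) : circle (t + 2 * pi * k%:~R) ->
  wrap t = t + 2 * pi * k%:~R.
Proof. by move=> /wrap_id <-; rewrite wrapD. Qed.

Lemma wrap_eq s t : wrap s = wrap t -> exists k : int, s = t + 2 * pi * k%:~R.
Proof.
have [k ->] := wrapE s; have [j ->] := wrapE t => /eqP h.
exists (j - k); apply/eqP; rewrite intrB mulrBr; move: h.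
by rewrite -subr_eq0 => /eqP h; rewrite -subr_eq0; apply/eqP; lra.
Qed.

(** The endpoints are those of a lift to the line, so the arc may pass through the point 0.
    Half-open arcs are used because cutting at a point partitions them exactly. *)
Definition cell a b : set R := wrap @` `[a, b[%classic.

Lemma cell_arc a b : arc (cell a b).
Proof. by exists `[a, b[%classic => //; exact: interval_is_interval. Qed.

Lemma cell_circle a b : cell a b `<=` circle.
Proof. by move=> _ [t _ <-]; exact: circle_wrap. Qed.

Lemma cell_addz a b (k : int) :
  cell (a + 2 * pi * k%:~R) (b + 2 * pi * k%:~R) = cell a b.
Proof.
apply/seteqP; split=> [x [t /=]|x [t /=]]; rewrite in_itv/= => /andP[ta tb] <-.
  exists (t - 2 * pi * k%:~R); last by rewrite -[RHS](wrapD _ (- k)) intrN mulrN.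
  by rewrite /= in_itv/=; apply/andP; split; lra.
exists (t + 2 * pi * k%:~R); last by rewrite wrapD.
by rewrite /= in_itv/=; apply/andP; split; lra.
Qed.

(** Translating the lift by a multiple of [2 * pi] puts its left end in [[0, 2 * pi[]. A cell of
    length at most [2 * pi] is then one interval, or two when it crosses 0. *)
Lemma cell_normal a b : exists a' b', [/\ 0 <= a', a' < 2 * pi, b' - a' = b - a &
  cell a b = cell a' b'].
Proof.
have [k Hk] := wrapE a; have := circle_wrap a.
rewrite /circle/= in_itv/= Hk => /andP[a0 a1].
exists (a + 2 * pi * k%:~R), (b + 2 * pi * k%:~R); split => //; first by lra.
by rewrite cell_addz.
Qed.

Lemma cell_small a b : 0 <= a -> b <= 2 * pi -> cell a b = `[a, b[%classic.
Proof.
move=> a0 b1; apply/seteqP; split=> [x [t /=]|t /=]; rewrite in_itv/= => /andP[ta tb].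
  move=> <-; rewrite wrap_id ?in_itv/= ?ta//.
  by rewrite /circle/= in_itv/=; apply/andP; split; lra.
exists t; first by rewrite /= in_itv/= ta.
rewrite wrap_id//.
by rewrite /circle/= in_itv/=; apply/andP; split; lra.
Qed.

Lemma cellU a b c : a <= b -> b <= c -> cell a c = cell a b `|` cell b c.
Proof.
move=> ab bc; rewrite /cell -image_setU; congr (_ @` _).
apply/seteqP; split=> t /=; rewrite !in_itv/=.
  move=> /andP[at_ tc]; have [tb|tb] := ltP t b; [left|right]; first by rewrite at_.
  by rewrite tc.
move=> [|] /andP[h1 h2]; apply/andP; split; lra.
Qed.

(** Lifts of a common point would differ by a positive multiple of [2 * pi], while the total span is
    at most [2 * pi] and excludes its right end. *)
Lemma cellI0 a b c : a <= b -> b <= c -> c <= a + 2 * pi ->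
  cell a b `&` cell b c = set0.
Proof.
move=> ab bc ca; rewrite -subset0 => x [[s /= sab <-] [t /= tbc]].
move: sab tbc; rewrite !in_itv/= => /andP[s1 s2] /andP[t1 t2] /wrap_eq[k tk].
have : 0 < 2 * pi * k%:~R :> R by lra.
rewrite pmulr_rgt0// ltr0z => k0.
have : 1 <= k%:~R :> R by rewrite ler1z -gtz0_ge1.
by rewrite -(ler_pM2l twopi_gt0) mulr1 => h; lra.
Qed.

Lemma cell_normal_split a b : a < 2 * pi -> 2 * pi <= b -> 0 <= a ->
  b <= a + 2 * pi ->
  cell a b = `[a, 2 * pi[%classic `|` `[0, b - 2 * pi[%classic.
Proof.
move=> a2 b2 a0 ba; rewrite (@cellU a (2 * pi))//; last by lra.
rewrite cell_small//; congr (_ `|` _).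
rewrite -[RHS]cell_small//; last by lra.
by rewrite -[RHS](cell_addz _ _ 1) mulr1 add0r subrK.
Qed.

Lemma measurable_cell a b : b <= a + 2 * pi -> measurable (cell a b : set (lebR R)).
Proof.
have [a' [b' [a0 a1 ab ->]]] := cell_normal a b.
move=> ba; have [b2|/ltW b2] := leP b' (2 * pi).
  by rewrite cell_small//; exact: itv_lebR.
rewrite cell_normal_split//; last by lra.
by apply: measurableU; exact: itv_lebR.
Qed.

Lemma arclength_cell a b : a <= b -> b <= a + 2 * pi ->
  arclength (cell a b) = (b - a)%:E.
Proof.
move=> ab ba; have [a' [b' [a0 a1 abE ->]]] := cell_normal a b.
have [b2|/ltW b2] := leP b' (2 * pi).
  by rewrite cell_small// arclength_itv; [rewrite abE|lra].
rewrite cell_normal_split//; last by lra.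
rewrite measureU; [|exact: itv_lebR|exact: itv_lebR|].
  by rewrite /= !arclength_itv ?subr0 -?EFinD -?abE; [congr (_%:E)| |]; lra.
rewrite -subset0 => x /= []; rewrite !in_itv/= => /andP[? ?] /andP[? ?]; lra.
Qed.

Lemma cell_sub a b a' b' : a' <= a -> b <= b' -> cell a b `<=` cell a' b'.
Proof.
move=> aa bb; apply: image_subset => t /=; rewrite !in_itv/= => /andP[h1 h2].
by apply/andP; split; lra.
Qed.

(** [wrap] jumps at the lifts of 0 and is locally a translation elsewhere; the radius keeps [s] in
    the same period as [t]. *)
Lemma wrap_near t U : wrap t != 0 -> open U -> U (wrap t) ->
  exists2 r, 0 < r & forall s, `|s - t| < r -> U (wrap s).
Proof.
move=> w0 oU Uw; have /nbhs_ballP[e /= e0 eU] : nbhs (wrap t) U by exact: open_nbhs_nbhs.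
have := circle_wrap t; rewrite /circle/= in_itv/= => /andP[w1 w2].
have {w0}w0 : 0 < wrap t by rewrite lt_neqAle eq_sym w0.
exists (Num.min e (Num.min (wrap t) (2 * pi - wrap t))).
  by rewrite !lt_min e0 w0 subr_gt0.
move=> s; rewrite !lt_min => /andP[h1 /andP[h2 h3]].
have [k Hk] := wrapE t.
have -> : wrap s = s + 2 * pi * k%:~R.
  apply: wrapE_circle; rewrite /circle/= in_itv/=.
  by move: h2 h3; rewrite Hk !ltr_norml => /andP[? ?] /andP[? ?]; apply/andP; split; lra.
apply: eU; rewrite /ball/= Hk.
by rewrite (_ : _ - _ = t - s); [rewrite distrC|lra].
Qed.

End arclength_theory.

Arguments circle_lebR {R}.

(** * Quantitative forms of the A_infty property on dyadic arcs *)

Section dyadic.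
Variable R : realType.

Definition mid (a b : R) : R := (a + b) / 2.

Lemma mid_itv (a b : R) : a < b -> a < mid a b /\ mid a b < b.
Proof. by rewrite /mid => ab; split; lra. Qed.

(** A union of leaves of a finite subdivision tree in which every node is split at its midpoint. As
    an inductive predicate it lets stopping-time selections be inductions on the tree. *)
Inductive dyadic : R -> R -> set R -> Prop :=
| dyadic0 a b : dyadic a b set0
| dyadic_cell a b : dyadic a b (cell a b)
| dyadicU a b V1 V2 : dyadic a (mid a b) V1 -> dyadic (mid a b) b V2 ->
    dyadic a b (V1 `|` V2).

Lemma dyadic_sub a b V : dyadic a b V -> a < b -> V `<=` cell a b.
Proof.
elim=> {a b V} [a b _|a b _|a b V1 V2 _ IH1 _ IH2 ab]; [exact: sub0set|by []|].
have [am mb] := mid_itv ab; rewrite (cellU (ltW am) (ltW mb)).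
by apply: setUSS; [exact: IH1|exact: IH2].
Qed.

Lemma measurable_dyadic a b V : dyadic a b V -> a < b -> b <= a + 2 * pi ->
  measurable (V : set (lebR R)).
Proof.
elim=> [//||{}a {}b V1 V2 _ IH1 _ IH2] => [? ? _ ?|ab ba]; first exact: measurable_cell.
have [am mb] := mid_itv ab.
by apply: measurableU; [apply: IH1|apply: IH2] => //; lra.
Qed.

Lemma dyadicC a b V : dyadic a b V -> a < b -> b <= a + 2 * pi ->
  dyadic a b (cell a b `\` V).
Proof.
elim=> [*|{}a {}b _ _|{}a {}b V1 V2 d1 IH1 d2 IH2 ab ba].
- by rewrite setD0; exact: dyadic_cell.
- by rewrite setDv; exact: dyadic0.
have [am mb] := mid_itv ab; rewrite (cellU (ltW am) (ltW mb)).
have I0 : cell a (mid a b) `&` cell (mid a b) b = set0.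
  by apply: cellI0; rewrite ?(ltW am) ?(ltW mb).
rewrite (_ : _ `\` _ = (cell a (mid a b) `\` V1) `|` (cell (mid a b) b `\` V2)).
  by apply: dyadicU; [apply: IH1|apply: IH2] => //; lra.
apply/seteqP; split=> x /=; first by tauto.
have d1x := dyadic_sub d1 am (t := x); have d2x := dyadic_sub d2 mb (t := x).
have nx : ~ (cell a (mid a b) x /\ cell (mid a b) b x).
  by move=> /= h; have : (cell a (mid a b) `&` cell (mid a b) b) x by []; rewrite I0.
by tauto.
Qed.

(** The union of the maximal subdivision cells, of generation at most [n], that lie in [O]. *)
Fixpoint inner (O : set R) n a b : set R :=
  if `[< cell a b `<=` O >] then cell a b
  else if n is n'.+1 then inner O n' a (mid a b) `|` inner O n' (mid a b) b
  else set0.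

Lemma dyadic_inner O n a b : dyadic a b (inner O n a b).
Proof.
elim: n a b => [|n IH] a b /=; case: ifP => _; first exact: dyadic_cell.
- exact: dyadic0.
- exact: dyadic_cell.
- by apply: dyadicU.
Qed.

Lemma inner_sub O n a b : inner O n a b `<=` O.
Proof.
elim: n a b => [|n IH] a b /=; case: asboolP => // _; first exact: sub0set.
by move=> x [/IH|/IH].
Qed.

Lemma inner_mono O n a b : inner O n a b `<=` inner O n.+1 a b.
Proof.
elim: n a b => [|n IH] a b; first by move=> x /=; case: asboolP => // _ [].
change (inner O n.+1 a b) with (if `[< cell a b `<=` O >] then cell a b
  else inner O n a (mid a b) `|` inner O n (mid a b) b).
change (inner O n.+2 a b) with (if `[< cell a b `<=` O >] then cell a b
  else inner O n.+1 a (mid a b) `|` inner O n.+1 (mid a b) b).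
case: asboolP => _; first exact: subset_refl.
by move=> x [/IH h|/IH h]; [left|right].
Qed.

Lemma inner_nondecreasing O a b : nondecreasing_seq (fun n => inner O n a b).
Proof.
by apply/nondecreasing_seqP => n; apply/subsetPset; exact: inner_mono.
Qed.

(** After [n] halvings the cell around [t] is shorter than [r], hence inside [O], unless a larger
    cell was selected before. *)
Lemma inner_mem O n a b t r : a <= t -> t < b ->
  (forall s, `|s - t| < r -> O (wrap s)) -> b - a < r * 2 ^+ n ->
  inner O n a b (wrap t).
Proof.
elim: n a b => [|n IH] a b at_ tb Or bar /=; case: asboolP => [_|nO].
- by exists t; rewrite //= in_itv/= at_.
- exfalso; apply: nO => x [s /=]; rewrite in_itv/= => /andP[s1 s2] <-; apply: Or.
  by rewrite expr0 mulr1 in bar; rewrite ltr_norml; apply/andP; split; lra.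
- by exists t; rewrite //= in_itv/= at_.
have [tm|mt] := ltP t (mid a b); [left|right]; apply: IH => //; move: bar;
  by rewrite exprS mulrCA /mid; set x := r * _; lra.
Qed.

End dyadic.

(** * Iterated density selection for a measure on one cell *)

Section cz.
Variable R : realType.
Variable nu : {measure set (lebR R) -> \bar R}.
Variables (a0 b0 : R).
Hypothesis ab0 : a0 < b0.
Hypothesis ba0 : b0 <= a0 + 2 * pi.
Hypothesis nufin : (nu (cell a0 b0) < +oo)%E.

Local Notation m A := (fine (arclength A)).
Local Notation v A := (fine (nu A)).
Local Notation mb A := (measurable (A : set (lebR R))).
Local Notation I0 := (cell a0 b0).

Let mI0 : mb I0. Proof. exact: measurable_cell. Qed.

(* lra does not look at section hypotheses *)
Ltac slra := move: (ab0) (ba0) => ? ?; lra.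

Let vE A : mb A -> A `<=` I0 -> nu A = (v A)%:E.
Proof.
move=> mA AI; rewrite fineK// ge0_fin_numE//.
by rewrite (le_lt_trans _ nufin)// le_measure ?inE.
Qed.

Let mE A : mb A -> A `<=` I0 -> arclength A = (m A)%:E.
Proof.
move=> mA AI; rewrite fineK// ge0_fin_numE//.
apply: (@le_lt_trans _ _ (arclength I0)); first by rewrite le_measure ?inE.
by rewrite arclength_cell ?ltry// ltW.
Qed.

Let vU A B : mb A -> mb B -> A `<=` I0 -> B `<=` I0 -> A `&` B = set0 ->
  v (A `|` B) = v A + v B.
Proof.
move=> mA mB AI BI AB; apply: EFin_inj; rewrite EFinD -!vE//.
- by rewrite measureU.
- exact: measurableU.
- by rewrite subUset.
Qed.

Let mU A B : mb A -> mb B -> A `<=` I0 -> B `<=` I0 -> A `&` B = set0 ->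
  m (A `|` B) = m A + m B.
Proof.
move=> mA mB AI BI AB; apply: EFin_inj; rewrite EFinD -!mE//.
- by rewrite measureU.
- exact: measurableU.
- by rewrite subUset.
Qed.

Let v_mono A B : mb A -> mb B -> B `<=` I0 -> A `<=` B -> v A <= v B.
Proof.
move=> mA mB BI AB; rewrite -lee_fin -!vE//; last exact: subset_trans BI.
by rewrite le_measure ?inE.
Qed.

Let v_ge0 A : 0 <= v A. Proof. exact: fine_ge0. Qed.

Let m_cell a b : a0 <= a -> a <= b -> b <= b0 -> m (cell a b) = b - a.
Proof. by move=> ? ? ?; rewrite arclength_cell//; slra. Qed.

Let cI a b : a0 <= a -> b <= b0 -> cell a b `<=` I0.
Proof. exact: cell_sub. Qed.

Let mcell a b : a0 <= a -> b <= b0 -> mb (cell a b).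
Proof. by move=> ? ?; apply: measurable_cell; slra. Qed.

Variables (e d : R).
Hypotheses (e0 : 0 < e) (e1 : e < 1) (d0 : 0 < d) (d1 : d < 1).
Hypothesis ctl : forall a b, a0 <= a -> a < b -> b <= b0 ->
  forall E, mb E -> E `<=` cell a b -> m E < d * (b - a) -> v E <= e * v (cell a b).

Let dyI a b V : a0 <= a -> a < b -> b <= b0 -> dyadic a b V ->
  mb V /\ V `<=` I0.
Proof.
move=> aa ab bb dV; split; first by apply: measurable_dyadic dV _ _ => //; slra.
by apply: subset_trans (dyadic_sub dV ab) _; exact: cI.
Qed.

Let dyU a b V1 V2 : a0 <= a -> a < b -> b <= b0 ->
  dyadic a (mid a b) V1 -> dyadic (mid a b) b V2 ->
  m (V1 `|` V2) = m V1 + m V2 /\ v (V1 `|` V2) = v V1 + v V2.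
Proof.
move=> aa ab bb D1 D2; have [am mb_] := mid_itv ab.
have [m1 s1] : mb V1 /\ V1 `<=` I0 by apply: dyI D1 => //; slra.
have [m2 s2] : mb V2 /\ V2 `<=` I0 by apply: dyI D2 => //; slra.
have V12 : V1 `&` V2 = set0.
  apply: subsetI_eq0 (dyadic_sub D1 am) (dyadic_sub D2 mb_) _.
  by apply: cellI0; slra.
by rewrite mU ?vU.
Qed.

Ltac slra ::= move: (ab0) (ba0) (e0) (e1) (d0) (d1) => ? ? ? ? ? ?; lra.
Ltac snra := move: (ab0) (ba0) (e0) (e1) (d0) (d1) => ? ? ? ? ? ?; nra.

Section upper.
Variable th : R.
Hypothesis th0 : 0 < th.
Hypothesis thd : 2 * th < d.

Ltac slra ::= move: (th0) (thd) (ab0) (ba0) (e0) (e1) (d0) (d1) => ? ? ? ? ? ? ? ?; lra.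
Ltac snra ::= move: (th0) (thd) (ab0) (ba0) (e0) (e1) (d0) (d1) => ? ? ? ? ? ? ? ?; nra.

(* Calderon-Zygmund selection: [W] is the union of the maximal cells in which
   [V] has density more than [th]. *)
Let upper_step a b V : dyadic a b V -> a0 <= a -> a < b -> b <= b0 ->
  m V <= 2 * th * (b - a) ->
  exists W, [/\ dyadic a b W, th * m W <= m V & v V <= e * v W].
Proof.
elim=> [{}a {}b|{}a {}b|{}a {}b V1 V2 D1 IH1 D2 IH2] aa ab bb mV.
- exists set0; split; first exact: dyadic0.
    by rewrite !measure0 mulr0.
  by rewrite !measure0 mulr0.
- have : 0 < (1 - 2 * th) * (b - a).
    by rewrite mulr_gt0// subr_gt0// (lt_trans thd).
  by move: mV; rewrite m_cell ?(ltW ab)//; lra.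
have [am mb_] := mid_itv ab.
have [mV12 vV12] := dyU aa ab bb D1 D2.
have [mm|mm] := leP (m (V1 `|` V2)) (th * (b - a)); last first.
  (* The density lies between [th] and [2 * th < d]: the cell is selected, and [ctl] bounds the mass
     of [V] in it. *)
  have dV : dyadic a b (V1 `|` V2) by exact: dyadicU.
  have [mbV _] := dyI aa ab bb dV.
  exists (cell a b); split; first exact: dyadic_cell.
    by rewrite m_cell ?(ltW ab) ?(ltW mm)//.
  have dth : 0 < (d - 2 * th) * (b - a) by rewrite mulr_gt0// subr_gt0.
  by apply: ctl => //; [exact: dyadic_sub|lra].
have ma0 : a0 <= mid a b by exact: le_trans (ltW am).
have mb0 : mid a b <= b0 by exact: le_trans (ltW mb_) bb.
(* Density at most [th] in the parent gives density at most [2 * th] in each half, which is the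
   hypothesis of the recursion. *)
have E1 : 2 * th * (mid a b - a) = th * (b - a) by rewrite /mid; field.
have E2 : 2 * th * (b - mid a b) = th * (b - a) by rewrite /mid; field.
have mV1 : m V1 <= 2 * th * (mid a b - a).
  by rewrite E1 (le_trans _ mm)// mV12 lerDl fine_ge0.
have mV2 : m V2 <= 2 * th * (b - mid a b).
  by rewrite E2 (le_trans _ mm)// mV12 lerDr fine_ge0.
have [W1 [dW1 mW1 vW1]] := IH1 aa am mb0 mV1.
have [W2 [dW2 mW2 vW2]] := IH2 ma0 mb_ bb mV2.
have [mW12 vW12] := dyU aa ab bb dW1 dW2.
exists (W1 `|` W2); split; first exact: dyadicU.
  by rewrite mW12 mV12 mulrDr lerD.
by rewrite vV12 vW12 mulrDr lerD.
Qed.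

(** One selection replaces [V] by a set at most [th^-1] times as long and gains a factor [e] in
    mass; [k] selections are possible before the length bound becomes that of the whole cell. *)
Lemma dyadic_upper k V : dyadic a0 b0 V -> m V <= th ^+ k * (b0 - a0) ->
  v V <= e ^+ k * v I0.
Proof.
elim: k V => [|k IH] V dV mV.
  by have [mbV VI] := dyI (lexx _) ab0 (lexx _) dV; rewrite expr0 mul1r v_mono.
have thk : th ^+ k <= 1 by apply: exprn_ile1; slra.
have thk0 : 0 <= th ^+ k by apply: exprn_ge0; slra.
have [||||W [dW mW vW]] := upper_step dV; rewrite ?lexx//.
  apply: (le_trans mV); rewrite exprS; apply: ler_wpM2r; first by rewrite subr_ge0 ltW.
  by have := ler_wpM2l (ltW th0) thk; slra.
have := IH W dW; rewrite exprS => {}IH.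
apply: (le_trans vW); rewrite -mulrA ler_wpM2l//; first by slra.
apply: IH; rewrite -(ler_pM2l th0) (le_trans mW)//.
by move: mV; rewrite exprS -mulrA.
Qed.

End upper.

Ltac slra ::= move: (ab0) (ba0) (e0) (e1) (d0) (d1) => ? ? ? ? ? ?; lra.
Ltac snra ::= move: (ab0) (ba0) (e0) (e1) (d0) (d1) => ? ? ? ? ? ?; nra.


Let split a b c : a0 <= a -> a <= b -> b <= c -> c <= b0 ->
  v (cell a c) = v (cell a b) + v (cell b c).
Proof.
move=> aa ab bc cb; rewrite (cellU ab bc) vU//.
- by apply: mcell; slra.
- by apply: mcell; slra.
- by apply: cI; slra.
- by apply: cI; slra.
- by apply: cellI0; slra.
Qed.

Let q := 1 - d / 2.

(** Cutting off the right end of relative length [d / 2 < d] removes at most the fraction [e] of the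
    mass; this is done [n] times. *)
Let shrink_left n a b : a0 <= a -> a < b -> b <= b0 ->
  (1 - e) ^+ n * v (cell a b) <= v (cell a (a + q ^+ n * (b - a))).
Proof.
move=> aa ab bb; have q0 : 0 < q by rewrite /q; slra.
have q1 : q < 1 by rewrite /q; slra.
elim: n => [|n IH]; first by rewrite !expr0 !mul1r addrCA subrr addr0.
have qn : q ^+ n <= 1 by apply: exprn_ile1; slra.
have qn0 : 0 < q ^+ n by apply: exprn_gt0; slra.
set l := q ^+ n * (b - a) in IH.
have l0 : 0 < l by rewrite mulr_gt0// subr_gt0.
have l1 : l <= b - a by rewrite /l ler_piMl// subr_ge0 ltW.
have -> : q ^+ n.+1 * (b - a) = q * l by rewrite exprS mulrA.
have ql : q * l < l by rewrite gtr_pMl.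
have ql0 : 0 < q * l by rewrite mulr_gt0.
have dl : 0 < d * l by rewrite mulr_gt0.
have vs : v (cell a (a + l)) = v (cell a (a + q * l)) + v (cell (a + q * l) (a + l)).
  by apply: split; slra.
have : v (cell (a + q * l) (a + l)) <= e * v (cell a (a + l)).
  apply: ctl => //; try slra.
  - by apply: mcell; slra.
  - by apply: cell_sub; slra.
  - by rewrite m_cell; [rewrite /q; slra|slra..].
rewrite vs in IH * => h; apply: (@le_trans _ _ ((1 - e) * (v (cell a (a + q * l)) + v (cell (a + q * l) (a + l))))).
  by rewrite exprS -mulrA ler_wpM2l//; slra.
slra.
Qed.

Let shrink_right n a b : a0 <= a -> a < b -> b <= b0 ->
  (1 - e) ^+ n * v (cell a b) <= v (cell (b - q ^+ n * (b - a)) b).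
Proof.
move=> aa ab bb; have q0 : 0 < q by rewrite /q; slra.
have q1 : q < 1 by rewrite /q; slra.
elim: n => [|n IH]; first by rewrite !expr0 !mul1r opprB addrCA subrr addr0.
have qn : q ^+ n <= 1 by apply: exprn_ile1; slra.
have qn0 : 0 < q ^+ n by apply: exprn_gt0; slra.
set l := q ^+ n * (b - a) in IH.
have l0 : 0 < l by rewrite mulr_gt0// subr_gt0.
have l1 : l <= b - a by rewrite /l ler_piMl// subr_ge0 ltW.
have -> : q ^+ n.+1 * (b - a) = q * l by rewrite exprS mulrA.
have ql : q * l < l by rewrite gtr_pMl.
have ql0 : 0 < q * l by rewrite mulr_gt0.
have dl : 0 < d * l by rewrite mulr_gt0.
have vs : v (cell (b - l) b) = v (cell (b - l) (b - q * l)) + v (cell (b - q * l) b).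
  by apply: split; slra.
have : v (cell (b - l) (b - q * l)) <= e * v (cell (b - l) b).
  apply: ctl => //; try slra.
  - by apply: mcell; slra.
  - by apply: cell_sub; slra.
  - by rewrite m_cell; [rewrite /q; slra|slra..].
rewrite vs in IH * => h; apply: (@le_trans _ _ ((1 - e) * (v (cell (b - l) (b - q * l)) + v (cell (b - q * l) b)))).
  by rewrite exprS -mulrA ler_wpM2l//; slra.
slra.
Qed.

Section lower.
Variable N : nat.
Hypothesis qN : q ^+ N <= 2^-1.

(** The mass cost of passing from a selected cell to its parent: [N] factors [1 - e] for the halving
    and one for the density of [V] in the cell. *)
Let C := ((1 - e) ^+ N.+1)^-1.

Let C_gt0 : 0 < C.
Proof. by rewrite invr_gt0 exprn_gt0//; slra. Qed.

Let C_ge1 : 1 <= C.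
Proof. by rewrite invf_ge1 ?exprn_ile1 ?exprn_gt0//; slra. Qed.

(** Since [q ^+ N] is at most one half, what [N] cuts leave is contained in the left half. *)
Let half_left a b : a0 <= a -> a < b -> b <= b0 ->
  (1 - e) ^+ N * v (cell a b) <= v (cell a (mid a b)).
Proof.
move=> aa ab bb; have [am mb_] := mid_itv ab.
apply: (le_trans (shrink_left N aa ab bb)); apply: v_mono.
- have : q ^+ N * (b - a) <= 1 * (b - a).
    apply: ler_wpM2r; first by rewrite subr_ge0 ltW.
    by apply: (le_trans qN); lra.
  by move=> h; apply: mcell; slra.
- by apply: mcell; slra.
- by apply: cI; slra.
- apply: cell_sub => //; rewrite /mid.
  suff : q ^+ N * (b - a) <= 2^-1 * (b - a) by slra.
  by apply: ler_wpM2r => //; rewrite subr_ge0 ltW.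
Qed.

Let half_right a b : a0 <= a -> a < b -> b <= b0 ->
  (1 - e) ^+ N * v (cell a b) <= v (cell (mid a b) b).
Proof.
move=> aa ab bb; have [am mb_] := mid_itv ab.
apply: (le_trans (shrink_right N aa ab bb)); apply: v_mono.
- have : q ^+ N * (b - a) <= 1 * (b - a).
    apply: ler_wpM2r; first by rewrite subr_ge0 ltW.
    by apply: (le_trans qN); lra.
  by move=> h; apply: mcell; slra.
- by apply: mcell; slra.
- by apply: cI; slra.
- apply: cell_sub => //; rewrite /mid.
  suff : q ^+ N * (b - a) <= 2^-1 * (b - a) by slra.
  by apply: ler_wpM2r => //; rewrite subr_ge0 ltW.
Qed.

(** The complement of [V] in the cell has relative length below [d / 2], so [ctl] gives it at most
    the fraction [e] of the mass. *)
Let full a b V : a0 <= a -> a < b -> b <= b0 -> dyadic a b V ->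
  q * (b - a) < m V -> (1 - e) * v (cell a b) <= v V.
Proof.
move=> aa ab bb dV mV; have [mbV _] := dyI aa ab bb dV.
have VI := dyadic_sub dV ab.
have dVC : dyadic a b (cell a b `\` V) by apply: dyadicC => //; slra.
have [mbVC VCI] := dyI aa ab bb dVC.
have cE : V `|` (cell a b `\` V) = cell a b by rewrite setDUK.
have V0 : V `&` (cell a b `\` V) = set0 by rewrite setDIK.
have VI0 : V `<=` I0 by apply: subset_trans VI _; exact: cI.
have mc := mU mbV mbVC VI0 VCI V0.
have vc := vU mbV mbVC VI0 VCI V0.
rewrite cE in mc vc.
have : v (cell a b `\` V) <= e * v (cell a b).
  have : 0 < d * (b - a) by apply: mulr_gt0; slra.
  by move=> dba; apply: ctl => //; rewrite m_cell ?(ltW ab)// in mc; rewrite /q in mV; lra.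
by slra.
Qed.

(* [W] is the union of the parents of the maximal cells in which [V] has
   density more than [q]; passing to the parent costs only the factor [C]. *)
Let lower_step a b V : dyadic a b V -> a0 <= a -> a < b -> b <= b0 ->
  m V <= q * (b - a) ->
  exists W, [/\ dyadic a b W, m V <= q * m W & v W <= C * v V].
Proof.
have q0 : 0 < q by rewrite /q; slra.
have q1 : q < 1 by rewrite /q; slra.
have ee : 0 < 1 - e by slra.
have eN : 0 < (1 - e) ^+ N.+1 by exact: exprn_gt0.
elim=> [{}a {}b|{}a {}b|{}a {}b V1 V2 D1 IH1 D2 IH2] aa ab bb mV.
- exists set0; split; first exact: dyadic0.
    by rewrite !measure0 mulr0.
  by rewrite !measure0 mulr0.
- have : 0 < (1 - q) * (b - a) by apply: mulr_gt0; lra.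
  by move: mV; rewrite m_cell ?(ltW ab)//; lra.
have [am mb_] := mid_itv ab.
have [mV12 vV12] := dyU aa ab bb D1 D2.
have v1 := v_ge0 V1; have v2 := v_ge0 V2.
have [mm1|mm1] := leP (m V1) (q * (mid a b - a)); last first.
  exists (cell a b); split; first exact: dyadic_cell.
    by rewrite m_cell ?(ltW ab)//.
  have h : (1 - e) * v (cell a (mid a b)) <= v V1 by apply: full => //; lra.
  have h' := half_left aa ab bb; rewrite -(ler_pM2l ee) in h'.
  by rewrite /C [leRHS]mulrC ler_pdivlMr// vV12 mulrC exprS -mulrA; lra.
have [mm2|mm2] := leP (m V2) (q * (b - mid a b)); last first.
  exists (cell a b); split; first exact: dyadic_cell.
    by rewrite m_cell ?(ltW ab)//.
  have h : (1 - e) * v (cell (mid a b) b) <= v V2 by apply: full => //; lra.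
  have h' := half_right aa ab bb; rewrite -(ler_pM2l ee) in h'.
  by rewrite /C [leRHS]mulrC ler_pdivlMr// vV12 mulrC exprS -mulrA; lra.
have ma0 : a0 <= mid a b by exact: le_trans (ltW am).
have mb0 : mid a b <= b0 by exact: le_trans (ltW mb_) bb.
have [W1 [dW1 mW1 vW1]] := IH1 aa am mb0 mm1.
have [W2 [dW2 mW2 vW2]] := IH2 ma0 mb_ bb mm2.
have [mW12 vW12] := dyU aa ab bb dW1 dW2.
exists (W1 `|` W2); split; first exact: dyadicU.
  by rewrite mW12 mV12 mulrDr lerD.
by rewrite vV12 vW12 mulrDr lerD.
Qed.

(** Each selection lengthens the set by a factor [q^-1] at a mass cost [C]. After at most [k] of
    them the density in the whole cell exceeds [q], and [full] costs the last factor. *)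
Lemma dyadic_lower k V : dyadic a0 b0 V -> q ^+ k * (b0 - a0) <= m V ->
  v I0 <= C ^+ k.+1 * v V.
Proof.
have q0 : 0 < q by rewrite /q; slra.
have q1 : q < 1 by rewrite /q; slra.
have ee : 0 < 1 - e by slra.
have direct W : dyadic a0 b0 W -> q * (b0 - a0) < m W -> v I0 <= C * v W.
  move=> dW mW; rewrite mulrC ler_pdivlMr ?exprn_gt0//.
  apply: le_trans (full (lexx _) ab0 (lexx _) dW mW).
  rewrite exprS mulrC -mulrA ler_wpM2l ?(ltW ee)// ler_piMl// exprn_ile1//; slra.
elim: k V => [|k IH] V dV mV.
  rewrite expr1; apply: direct => //; apply: lt_le_trans mV.
  by rewrite expr0 ltr_pM2r// subr_gt0.
have [mm|mm] := leP (m V) (q * (b0 - a0)); last first.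
  apply: (le_trans (direct _ dV mm)); rewrite ler_wpM2r//.
  by rewrite exprS ler_peMr ?exprn_ege1// ltW.
have [||||W [dW mW vW]] := lower_step dV; rewrite ?lexx//.
have /IH : q ^+ k * (b0 - a0) <= m W.
  by rewrite -(ler_pM2l q0) mulrA -exprS; exact: le_trans mW.
move=> /(_ dW) h; apply: (le_trans h); rewrite [in leRHS]exprSr -mulrA.
by rewrite ler_wpM2l// exprn_ge0// ltW.
Qed.

End lower.

Hypothesis nu1 : forall x, nu [set x] = 0%E.

(** An open set slightly longer than [E] is exhausted from inside, up to the point 0, by an
    increasing sequence of dyadic unions; continuity from below passes the bound to the limit. *)
Lemma dyadic_approx E eta kap : mb E -> E `<=` I0 -> 0 < eta ->
  (forall V, dyadic a0 b0 V -> m V <= m E + eta -> v V <= kap) -> v E <= kap.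
Proof.
move=> mbE EI eta0 H.
have [U [oU EU mUE]] := arclength_outer E eta0.
pose V n := inner U n a0 b0.
have dV n : dyadic a0 b0 (V n) by exact: dyadic_inner.
have mV n : mb (V n) by apply: (dyI _ _ _ (dV n)).1; rewrite ?lexx.
have sV n : V n `<=` I0 by apply: (dyI _ _ _ (dV n)).2; rewrite ?lexx.
have mUV : mb (\bigcup_n V n) by exact: bigcupT_measurable.
have cv := nondecreasing_cvg_mu (mu := nu) mV mUV (inner_nondecreasing U a0 b0).
have le1 : (nu (\bigcup_n V n) <= kap%:E)%E.
  rewrite -(cvg_lim _ cv)//; apply: lime_le; first by apply/cvg_ex; eexists; exact: cv.
  near=> n; rewrite /= vE// lee_fin; apply: H => //.
  rewrite -lee_fin EFinD -!mE//; apply: le_trans mUE.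
  rewrite le_measure ?inE//; [exact: open_lebR|].
  exact: inner_sub.
rewrite -lee_fin -vE//; apply: le_trans le1.
(* The point 0, where [wrap] is discontinuous, is added separately as a null set. *)
have m1 : mb [set 0] by apply: borel_lebR; exact: measurable_set1.
apply: (@le_trans _ _ (nu ((\bigcup_n V n) `|` [set 0]))); last first.
  by rewrite measureU0//; exact: nu1.
rewrite le_measure ?inE//; first exact: measurableU.
move=> x Ex; have [->|x0] := eqVneq x 0; [by right|left].
have [t /=] := EI _ Ex; rewrite in_itv/= => /andP[at_ tb] tx.
have [||r r0 hr] := @wrap_near R t U _ oU; rewrite ?tx//; first exact: EU.
have [n nr] : exists n, (b0 - a0) / r < n%:R.
  by exists (Num.bound ((b0 - a0) / r)); apply: archi_boundP; rewrite divr_ge0// ?ltW// subr_gt0.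
exists n => //; rewrite -tx; apply: (inner_mem at_ tb hr).
rewrite mulrC -ltr_pdivrMr//; apply: (lt_le_trans nr).
by rewrite -natrX ler_nat ltnW// ltn_expl.
Unshelve. all: by end_near.
Qed.

End cz.

(** * Constants uniform over all controlled measures *)

Lemma expr_small (R : realType) (x y : R) : 0 <= x -> x < 1 -> 0 < y ->
  exists n, x ^+ n <= y.
Proof.
move=> x0 x1 y0; have : (fun n => x ^+ n) @ \oo --> (0 : R).
  by apply: cvg_expr; rewrite ger0_norm.
move=> /cvgrPdist_le/(_ _ y0)[n _ /(_ n (leqnn n))].
by rewrite sub0r normrN ger0_norm ?exprn_ge0//; exists n.
Qed.

(** The A_infty condition for a single measure on all subcells of one cell, with real values and a
    non-strict conclusion. *)
Definition controlled (R : realType) (nu : set (lebR R) -> \bar R) (e d a0 b0 : R) :=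
  forall a b, a0 <= a -> a < b -> b <= b0 ->
  forall E, measurable (E : set (lebR R)) -> E `<=` cell a b ->
    fine (arclength E) < d * (b - a) -> fine (nu E) <= e * fine (nu (cell a b)).

Lemma controlled_upper (R : realType) (e d eps : R) :
  0 < e -> e < 1 -> 0 < d -> d < 1 -> 0 < eps ->
  exists2 th : R, 0 < th &
  forall (nu : {measure set (lebR R) -> \bar R}) (a b : R), a < b -> b <= a + 2 * pi ->
  (nu (cell a b) < +oo)%E -> (forall x, nu [set x] = 0%E) -> controlled nu e d a b ->
  forall E, measurable (E : set (lebR R)) -> E `<=` cell a b ->
  fine (arclength E) <= th * (b - a) -> fine (nu E) <= eps * fine (nu (cell a b)).
Proof.
move=> e0 e1 d0 d1 eps0; have [k ek] : exists k, e ^+ k <= eps by apply: expr_small; lra.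
have d4 : 0 < d / 4 by lra.
have dk : 0 < (d / 4) ^+ k by exact: exprn_gt0.
(* The selection runs with [th = d / 4], so that [2 * th < d]. Half of the admissible length is kept
   as slack for the outer approximation. *)
exists ((d / 4) ^+ k / 2); first by lra.
move=> nu a b ab ba nufin nu1 ctl E mE EI mEle.
apply: (@dyadic_approx R nu a b ab ba nufin nu1 E ((d / 4) ^+ k / 2 * (b - a))) => //.
  by rewrite mulr_gt0 ?subr_gt0//; lra.
move=> V dV mV; apply: (@le_trans _ _ (e ^+ k * fine (nu (cell a b)))).
  apply: (@dyadic_upper R nu a b ab ba nufin e d e0 e1 d0 d1 ctl (d / 4)) => //; first by lra.
  by apply: (le_trans mV); lra.
by rewrite ler_wpM2r// fine_ge0.
Qed.

(** The complement [F] of [E] is approximated from outside by dyadic unions [V]. The complement of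
    [V] is dyadic and still has relative length at least [eta / 2], so it carries the fraction
    [C^-1] of the mass; hence [F] misses at least that fraction. *)
Lemma controlled_lower (R : realType) (e d eta : R) :
  0 < e -> e < 1 -> 0 < d -> d < 1 -> 0 < eta ->
  exists2 c : R, 0 < c &
  forall (nu : {measure set (lebR R) -> \bar R}) (a b : R), a < b -> b <= a + 2 * pi ->
  (nu (cell a b) < +oo)%E -> (forall x, nu [set x] = 0%E) -> controlled nu e d a b ->
  forall E, measurable (E : set (lebR R)) -> E `<=` cell a b ->
  eta * (b - a) <= fine (arclength E) -> c * fine (nu (cell a b)) <= fine (nu E).
Proof.
move=> e0 e1 d0 d1 eta0.
have [N qN] : exists N, (1 - d / 2) ^+ N <= 2^-1 by apply: expr_small; lra.
have [k qk] : exists k, (1 - d / 2) ^+ k <= eta / 2 by apply: expr_small; lra.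
set C := (((1 - e) ^+ N.+1)^-1) ^+ k.+1.
have C0 : 0 < C by rewrite exprn_gt0// invr_gt0 exprn_gt0//; lra.
exists C^-1; first by rewrite invr_gt0.
move=> nu a b ab ba nufin nu1 ctl E mE EI mEle.
have mI : measurable (cell a b : set (lebR R)) by exact: measurable_cell.
have finm A : measurable (A : set (lebR R)) -> A `<=` cell a b ->
    arclength A \is a fin_num.
  move=> mA AI; rewrite ge0_fin_numE// (@le_lt_trans _ _ (arclength (cell a b)))//.
    by rewrite le_measure ?inE.
  by rewrite arclength_cell ?ltry// ltW.
have finn A : measurable (A : set (lebR R)) -> A `<=` cell a b -> nu A \is a fin_num.
  move=> mA AI; rewrite ge0_fin_numE// (@le_lt_trans _ _ (nu (cell a b)))//.
  by rewrite le_measure ?inE.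
have splm A : measurable (A : set (lebR R)) -> A `<=` cell a b ->
    fine (arclength A) + fine (arclength (cell a b `\` A)) = b - a.
  move=> mA AI; have mC : measurable (cell a b `\` A : set (lebR R)) by exact: measurableD.
  rewrite -fineD ?finm// -measureU ?setDIK// setDUK//.
  by rewrite -[RHS]/(fine (b - a)%:E) -arclength_cell// ltW.
have spln A : measurable (A : set (lebR R)) -> A `<=` cell a b ->
    fine (nu A) + fine (nu (cell a b `\` A)) = fine (nu (cell a b)).
  move=> mA AI; have mC : measurable (cell a b `\` A : set (lebR R)) by exact: measurableD.
  by rewrite -fineD ?finn// -measureU ?setDIK// setDUK.
set F := cell a b `\` E.
have mF : measurable (F : set (lebR R)) by exact: measurableD.
have le0 : 0 < b - a by rewrite subr_gt0.
have : fine (nu F) <= (1 - C^-1) * fine (nu (cell a b)).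
  apply: (@dyadic_approx R nu a b ab ba nufin nu1 F (eta / 2 * (b - a))) => //.
  - exact: subDsetl.
  - by rewrite mulr_gt0//; lra.
  move=> V dV mV.
  have mVb : measurable (V : set (lebR R)) by exact: measurable_dyadic dV ab ba.
  have VI := dyadic_sub dV ab.
  have dVC := dyadicC dV ab ba.
  have := @dyadic_lower R nu a b ab ba nufin e d e0 e1 d0 d1 ctl N qN k _ dVC.
  have h1 := splm _ mVb VI; have h2 := spln _ mVb VI; have h3 := splm _ mE EI.
  have h4 : (1 - d / 2) ^+ k * (b - a) <= fine (arclength (cell a b `\` V)).
    apply: (@le_trans _ _ (eta / 2 * (b - a))); first by rewrite ler_wpM2r// ltW.
    by rewrite -/F in h3; lra.
  move=> /(_ h4); rewrite -/C mulrC -ler_pdivrMr// => h5.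
  by move: h2 h5; set x := fine (nu (cell a b)); rewrite mulrBl mul1r (mulrC C^-1); lra.
by have := spln _ mE EI; rewrite -/F; lra.
Qed.

(** * Measures with density and the modular *)

Section density.
Variable R : realType.

Record weight := Weight {
  wfun :> R -> R;
  wfun_ge0 : forall x, circle x -> 0 <= wfun x;
  wfun_measurable : circle_measurable wfun }.

(** Intersecting with [circle] gives a measure on the whole line although weights are constrained
    only on the circle. *)
Definition dens (w : weight) (A : set (lebR R)) : \bar R :=
  (\int[arclength]_(x in A `&` circle) (w x)%:E)%E.

Lemma weight_measurable (w : weight) (A : set (lebR R)) :
  measurable_fun (A `&` circle) (fun x : lebR R => (w x)%:E).
Proof.
apply: (measurable_funS circle_lebR); first exact: subIsetr.
by apply/measurable_EFinP; exact: wfun_measurable.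
Qed.

Lemma weight_ge0 (w : weight) (A : set R) x : (A `&` circle) x -> (0 <= (w x)%:E)%E.
Proof. by move=> [_ cx]; rewrite lee_fin; exact: wfun_ge0. Qed.

Section dens_measure.
Variable w : weight.

Let dens0 : dens w set0 = 0%E.
Proof. by rewrite /dens set0I integral_set0. Qed.

Let dens_ge0 A : (0 <= dens w A)%E.
Proof. by apply: integral_ge0 => x; exact: weight_ge0. Qed.

Let dens_sigma : semi_sigma_additive (dens w).
Proof.
move=> F mF tF mUF; rewrite /dens setI_bigcupl.
rewrite ge0_integral_bigcup//=.
- by apply: is_cvg_ereal_nneg_natsum => n _; exact: dens_ge0.
- by move=> k; apply: measurableI => //; exact: circle_lebR.
- by rewrite -setI_bigcupl; exact: weight_measurable.
- by rewrite -setI_bigcupl; exact: weight_ge0.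
- by apply/trivIsetP => i j _ _ ij; move/trivIsetP : tF => /(_ i j I I ij) Fij;
    rewrite setIACA Fij set0I.
Qed.

HB.instance Definition _ := isMeasure.Build _ _ _ (dens w) dens0 dens_ge0 dens_sigma.

End dens_measure.

Lemma densE (w : weight) (A : set R) : A `<=` circle ->
  dens w A = (\int[arclength]_(x in A) (w x)%:E)%E.
Proof. by move=> Ac; rewrite /dens (setIidl Ac). Qed.

Lemma dens_le (w w' : weight) (A : set R) : measurable (A : set (lebR R)) ->
  (forall x, circle x -> A x -> w x <= w' x) -> (dens w A <= dens w' A)%E.
Proof.
move=> mA ww; apply: ge0_le_integral.
- by apply: measurableI => //; exact: circle_lebR.
- by move=> x; exact: weight_ge0.
- exact: weight_measurable.
- exact: weight_measurable.
- by move=> x [Ax cx]; rewrite lee_fin; exact: ww.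
Qed.

Lemma dens_leZ (k : R) (w w' : weight) (A : set R) : 0 <= k ->
  measurable (A : set (lebR R)) ->
  (forall x, circle x -> A x -> w x <= k * w' x) -> (dens w A <= k%:E * dens w' A)%E.
Proof.
move=> k0 mA ww; have mAc : measurable (A `&` circle : set (lebR R)).
  by apply: measurableI => //; exact: circle_lebR.
rewrite /dens -ge0_integralZl_EFin; [|exact: mAc|exact: weight_ge0|exact: weight_measurable|exact: k0].
apply: ge0_le_integral; first exact: mAc.
- by move=> x; exact: weight_ge0.
- exact: weight_measurable.
- by apply: measurable_funeM; exact: weight_measurable.
- by move=> x [Ax cx]; rewrite -EFinM lee_fin; exact: ww.
Qed.

Lemma dens_leD (w1 w2 w3 w4 : weight) (A : set R) : measurable (A : set (lebR R)) ->
  (forall x, circle x -> A x -> w1 x + w2 x <= w3 x + w4 x) ->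
  (dens w1 A + dens w2 A <= dens w3 A + dens w4 A)%E.
Proof.
move=> mA ww; have mAc : measurable (A `&` circle : set (lebR R)).
  by apply: measurableI => //; exact: circle_lebR.
have P (w : weight) := @weight_ge0 w A.
have M (w : weight) := @weight_measurable w A.
rewrite /dens -!ge0_integralD//; try by move=> x; exact: P.
apply: ge0_le_integral; first exact: mAc.
- by move=> x Ax; apply: adde_ge0; exact: P.
- by apply: emeasurable_funD; exact: M.
- by apply: emeasurable_funD; exact: M.
- by move=> x [Ax cx]; rewrite -!EFinD lee_fin; exact: ww.
Qed.

Lemma dens_null (w : weight) (A : set R) : measurable (A : set (lebR R)) ->
  arclength A = 0%E -> dens w A = 0%E.
Proof.
move=> mA A0; apply: null_set_integral.
- by apply: measurableI => //; exact: circle_lebR.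
- exact: weight_measurable.
- apply/eqP; rewrite eq_le measure_ge0 andbT -A0 le_measure ?inE//.
  by apply: measurableI => //; exact: circle_lebR.
Qed.

Lemma dens_set1 (w : weight) (x : R) : dens w [set x] = 0%E.
Proof.
by apply: dens_null; [exact: borel_lebR|exact: arclength_set1].
Qed.

Lemma lin_weight_ge0 (k1 k2 : R) (w1 w2 : weight) x : circle x ->
  0 <= `|k1| * w1 x + `|k2| * w2 x.
Proof. by move=> cx; rewrite addr_ge0 ?mulr_ge0 ?wfun_ge0. Qed.

Lemma lin_weight_measurable (k1 k2 : R) (w1 w2 : weight) :
  circle_measurable (fun x => `|k1| * w1 x + `|k2| * w2 x).
Proof.
by apply: measurable_funD; apply: measurable_funM => //; exact: wfun_measurable.
Qed.

(** The absolute values make the combination a weight for all coefficients, so it can be formed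
    without carrying sign proofs. *)
Definition lin_weight (k1 k2 : R) (w1 w2 : weight) : weight :=
  Weight (@lin_weight_ge0 k1 k2 w1 w2) (lin_weight_measurable k1 k2 w1 w2).

Lemma dens_lin (k1 k2 : R) (w1 w2 : weight) (A : set R) :
  0 <= k1 -> 0 <= k2 -> measurable (A : set (lebR R)) ->
  dens (lin_weight k1 k2 w1 w2) A = (k1%:E * dens w1 A + k2%:E * dens w2 A)%E.
Proof.
move=> k10 k20 mA; have mAc : measurable (A `&` circle : set (lebR R)).
  by apply: measurableI => //; exact: circle_lebR.
rewrite /dens -!ge0_integralZl_EFin; first last.
all: try exact: mAc; try exact: weight_measurable; try exact: weight_ge0; try by [].
rewrite -ge0_integralD; first last.
- by apply: measurable_funeM; exact: weight_measurable.
- by move=> x xA; rewrite mule_ge0 ?lee_fin//; exact: weight_ge0 xA.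
- by apply: measurable_funeM; exact: weight_measurable.
- by move=> x xA; rewrite mule_ge0 ?lee_fin//; exact: weight_ge0 xA.
- exact: mAc.
by apply: eq_integral => x _; rewrite /= !ger0_norm.
Qed.

End density.

(** * Measurability and dominated convergence for the modular *)

Section modular_measurability.
Variables (R : realType) (Phi : R -> R -> R).
Hypothesis mf : modular_family Phi.

Lemma Phi_ge0 x t : circle x -> 0 <= t -> 0 <= Phi x t.
Proof. by move=> cx t0; have [/(_ x cx)[_ + _ _ _] _] := mf; exact. Qed.

Lemma Phi_0 x : circle x -> Phi x 0 = 0.
Proof. by move=> cx; have [/(_ x cx)[]] := mf. Qed.

Lemma Phi_le x s t : circle x -> 0 <= s -> s <= t -> Phi x s <= Phi x t.
Proof. by move=> cx s0 st; have [/(_ x cx)[_ _ + _ _] _] := mf; exact. Qed.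

Lemma Phi_cts x t e : circle x -> 0 <= t -> 0 < e ->
  exists2 r, 0 < r & forall s, 0 <= s -> `|s - t| < r -> `|Phi x s - Phi x t| < e.
Proof.
move=> cx t0 e0; have [/(_ x cx)[_ _ _ + _] _] := mf.
move=> /continuous_within_itvcyP[cin c0].
have [tp|t00] := ltP 0 t; last first.
  have te : t = 0 by apply/le_anti; rewrite t00 t0.
  move/cvgrPdist_lt : c0 => /(_ _ e0)[r /= r0 H]; exists r => // s s0.
  rewrite te => sr; move: s0; rewrite le_eqVlt => /predU1P[<-|sp].
    by rewrite subrr normr0.
  by rewrite distrC; apply: H => //; rewrite /= distrC.
have /cin : t \in `]0, +oo[ by rewrite in_itv/= tp.
move/cvgrPdist_lt => /(_ _ e0)[r /= r0 H]; exists r => // s s0 sr.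
by rewrite distrC; apply: H; rewrite /= distrC.
Qed.

Lemma circle_measurable_norm (f : R -> R) : circle_measurable f ->
  circle_measurable (fun x => `|f x|).
Proof. by move=> mfm; exact: measurableT_comp. Qed.

Lemma circle_measurableZ (k : R) (f : R -> R) : circle_measurable f ->
  circle_measurable (fun x => k * f x).
Proof. by move=> mfm; apply: measurable_funM => //; exact: measurable_cst. Qed.

Lemma circle_measurable_ge (f : R -> R) c : circle_measurable f ->
  measurable ([set x | circle x /\ c <= f x] : set (lebR R)).
Proof.
move=> mfm; rewrite (_ : [set x | _] = circle `&` f @^-1` `[c, +oo[%classic).
  by apply: (mfm circle_lebR); exact: measurable_itv.
by apply/seteqP; split => x /=; rewrite in_itv/= andbT.
Qed.

Lemma circle_measurable_gt (f : R -> R) c : circle_measurable f ->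
  measurable ([set x | circle x /\ c < f x] : set (lebR R)).
Proof.
move=> mfm; rewrite (_ : [set x | _] = circle `&` f @^-1` `]c, +oo[%classic).
  by apply: (mfm circle_lebR); exact: measurable_itv.
by apply/seteqP; split => x /=; rewrite in_itv/= andbT.
Qed.

Lemma circle_measurable_gtP (f : R -> R) :
  (forall c, measurable ([set x | circle x /\ c < f x] : set (lebR R))) ->
  circle_measurable f.
Proof.
move=> H mD; apply: (measurability _ (RGenOInfty.measurableE R)) => //.
move=> _ [_ [c ->] <-]; rewrite (_ : _ `&` _ = [set x | circle x /\ c < f x]) ?H//.
by apply/seteqP; split => x /=; rewrite in_itv/= andbT.
Qed.

(** [Phi] is measurable in the point and continuous in the argument. By monotonicity and continuity,
    [Phi x] exceeds [c] at [|f x|] exactly when it does so at some nonnegative rational at most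
    [|f x|], a countable union. *)
Lemma circle_measurable_Phi (f : R -> R) : circle_measurable f ->
  circle_measurable (fun x => Phi x `|f x|).
Proof.
move=> mfm; apply: circle_measurable_gtP => c.
have mn := circle_measurable_norm mfm.
rewrite (_ : [set x | _] = \bigcup_(q : rat) if (0 <= ratr q :> R) then
    [set x | circle x /\ ratr q <= `|f x|] `&` [set x | circle x /\ c < Phi x (ratr q)]
  else set0).
  apply: bigcupT_measurable_rat => q; case: ifPn => // q0.
  apply: measurableI; first exact: circle_measurable_ge.
  by apply: circle_measurable_gt; exact: mf.2.
apply/seteqP; split=> [x /= [cx cPhi]|x /= [q _]]; last first.
  case: ifPn => // q0 [[cx qf] [_ cq]]; split => //.
  by apply: (lt_le_trans cq); exact: Phi_le.
have [f0|f0] := ltP 0 `|f x|; last first.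
  have fe : `|f x| = 0 by apply/eqP; rewrite eq_le f0 normr_ge0.
  have q0 : ratr 0 = 0 :> R by rewrite rmorph0.
  by exists 0 => //=; rewrite q0 lexx/=; split; split; rewrite ?fe// -fe.
have [|r r0 H] := @Phi_cts x `|f x| (Phi x `|f x| - c) cx (normr_ge0 _).
  by rewrite subr_gt0.
have /rat_in_itvoo[q] : Num.max 0 (`|f x| - r) < `|f x|.
  by rewrite gt_max f0/= ltrBlDr ltrDl.
rewrite in_itv/= gt_max => /andP[/andP[q0 qr] qf].
exists q => //; rewrite ltW//; split; split => //; first exact: ltW.
have : `|ratr q - `|f x| | < r by rewrite ltr_norml; apply/andP; split; lra.
by move=> /(H _ (ltW q0)); rewrite ltr_norml => /andP[+ _]; lra.
Qed.

Definition Phi_weight (f : R -> R) (mfm : circle_measurable f) : weight R :=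
  Weight (fun x cx => Phi_ge0 cx (normr_ge0 (f x))) (circle_measurable_Phi mfm).

Definition level (l : R) : weight R :=
  Phi_weight (measurable_cst l : circle_measurable (cst l)).

Lemma modularE f (mfm : circle_measurable f) :
  modular Phi f = dens (Phi_weight mfm) circle.
Proof. by rewrite densE. Qed.

Lemma level_measureE l (E : set R) : 0 <= l -> E `<=` circle ->
  level_measure Phi l E = dens (level l) E.
Proof. by move=> l0 Ec; rewrite densE//= ger0_norm. Qed.

(** Dominated convergence with majorant [Phi x |f x|]; the pointwise limit is 0 by continuity of
    [Phi x] at 0. *)
Lemma modular_cvg0 (f : R -> R) (h : nat -> R -> R) :
  circle_measurable f -> (forall n, circle_measurable (h n)) ->
  (forall n x, circle x -> `|h n x| <= `|f x|) ->
  (forall x, circle x -> h n x @[n --> \oo] --> (0 : R)) ->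
  (modular Phi f < +oo)%E -> modular Phi (h n) @[n --> \oo] --> (0 : \bar R).
Proof.
move=> mfm mh hf h0 fin.
have EM g : circle_measurable g ->
    measurable_fun (circle : set (lebR R)) (fun x => (Phi x `|g x|)%:E).
  by move=> mg; apply/measurable_EFinP; exact: circle_measurable_Phi.
rewrite (_ : (0 : \bar R) = \int[arclength]_(x in circle) (cst 0%E x))%E; last first.
  by rewrite integral0.
apply: (@dominated_cvg _ _ _ _ _ circle_lebR _ _ (fun x => (Phi x `|f x|)%:E)).
- by move=> n; exact: EM.
- move=> x cx; apply: cvg_EFin; first exact: nearW.
  apply/cvgrPdist_lt => e e0.
  have [r r0 H] := Phi_cts cx (lexx 0) e0.
  have /cvgrPdist_lt/(_ _ r0)[N _ HN] := h0 x cx.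
  exists N => // n /HN; rewrite /= sub0r normrN => hr.
  rewrite sub0r normrN -[X in `|X|]subr0 -(Phi_0 cx); apply: H => //.
  by rewrite subr0 normr_id.
- by [].
- apply/integrableP; split; first exact: EM.
  rewrite [ltLHS](_ : _ = modular Phi f)//; apply: eq_integral => x.
  by rewrite inE => cx; rewrite gee0_abs// lee_fin Phi_ge0.
- move=> n x cx; rewrite gee0_abs ?lee_fin ?Phi_ge0//.
  by apply: Phi_le => //; exact: hf.
Qed.

End modular_measurability.

(** * Components of open subsets of the circle *)

Section pieces.
Variable R : realType.
Implicit Types (U V A : set R) (x y t s : R).

(** The connected component of the lift [t] in the preimage of [U] under [wrap], described by
    segments. *)
Definition comp U t : set R :=
  [set s | forall r, Num.min s t <= r <= Num.max s t -> U (wrap r)].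

Lemma comp_refl U t : U (wrap t) -> comp U t t.
Proof. by move=> Ut r; rewrite minxx maxxx => /le_anti <-. Qed.

Lemma comp_sub U t s : comp U t s -> U (wrap s).
Proof. by apply; rewrite ge_min lexx le_max lexx. Qed.

Lemma comp_sym U t s : comp U t s -> comp U s t.
Proof. by move=> h r; rewrite minC maxC; exact: h. Qed.

Lemma comp_trans U t s r : comp U t s -> comp U s r -> comp U t r.
Proof.
move=> ts sr z; rewrite ge_min le_max => h.
have [zt|zt] := leP z t; have [zs|zs] := leP z s.
- have rz : r <= z \/ z = t by case/andP: h => /orP[|tz]; [left|right; apply/le_anti/andP].
  case: rz => [rz|->]; first by apply: sr; rewrite ge_min le_max rz zs orbT.
  by apply: ts; rewrite ge_min le_max !lexx !orbT.
- by apply: ts; rewrite ge_min le_max zt (ltW zs) orbT.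
- by apply: ts; rewrite ge_min le_max zs (ltW zt) orbT.
- have rz : z <= r by case/andP: h => _ /orP[//|]; rewrite leNgt zt.
  by apply: sr; rewrite ge_min le_max rz (ltW zs) orbT.
Qed.

Lemma comp_eq U t s : comp U t s -> comp U s = comp U t.
Proof.
move=> ts; apply/seteqP; split=> r; first exact: comp_trans.
by apply: comp_trans; exact: comp_sym.
Qed.

Lemma comp_itv U t : is_interval (comp U t).
Proof.
move=> a b ta tb c /andP[ac cb] r; rewrite ge_min le_max => /andP[h1 h2].
have [rt|rt] := leP r t.
- apply: ta; rewrite ge_min le_max rt orbT andbT.
  by case/orP: h1 => [/(le_trans ac)->//|->]; rewrite orbT.
- apply: tb; rewrite ge_min le_max (ltW rt) orbT/=.
  by case/orP: h2 => [/le_trans->//|]; rewrite leNgt rt.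
Qed.

Lemma comp_open U t : open [set r | U (wrap r)] -> open (comp U t).
Proof.
move=> oU; rewrite openE => s /[dup] ts /comp_sub Us.
have /nbhs_ballP[e /= e0 eU] : nbhs s [set r | U (wrap r)] by exact: open_nbhs_nbhs.
apply/nbhs_ballP; exists e => // s' /= ss'; apply: comp_trans ts _.
move=> r; rewrite ge_min le_max => h; apply: eU; move: ss'; rewrite /ball/= !ltr_norml.
move=> /andP[h1 h2]; apply/andP; case/andP: h => /orP[] h3 /orP[] h4; split; lra.
Qed.

Lemma compD U t (k : int) s : comp U t s ->
  comp U (t + 2 * pi * k%:~R) (s + 2 * pi * k%:~R).
Proof.
move=> ts r; rewrite -addr_minl -addr_maxl => /andP[h1 h2].
have h : Num.min s t <= r - 2 * pi * k%:~R <= Num.max s t by apply/andP; split; lra.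
by have := ts _ h; rewrite -mulrN -intrN wrapD.
Qed.

(* The component of [x] in [U], computed in the preimage of [U] on the line. *)
Definition piece U x : set R := wrap @` comp U x.

(** The preimage of [U] is periodic, so the component has the same image whichever lift is
    chosen. *)
Lemma piece_wrap U t : piece U (wrap t) = piece U t.
Proof.
have [k tk] := wrapE t; apply/seteqP; split=> y [s ts <-].
  exists (s - 2 * pi * k%:~R); last by rewrite -mulrN -intrN wrapD.
  by have := @compD U _ (- k) _ ts; rewrite tk intrN mulrN addrK.
by exists (s + 2 * pi * k%:~R); [rewrite tk; exact: compD|rewrite wrapD].
Qed.

Lemma piece_eq U x y : piece U x y -> piece U y = piece U x.
Proof. by move=> [s xs <-]; rewrite piece_wrap /piece (comp_eq xs). Qed.

Lemma piece_mem U x : circle x -> U x -> piece U x x.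
Proof. by move=> cx Ux; exists x; [apply: comp_refl|]; rewrite wrap_id. Qed.

Lemma piece_sub U x : piece U x `<=` U.
Proof. by move=> _ [s /comp_sub xs <-]. Qed.

Lemma piece_mono U V x : U `<=` V -> piece U x `<=` piece V x.
Proof. by move=> UV; apply: image_subset => s h r /h /UV. Qed.

Lemma piece_circle U x : piece U x `<=` circle.
Proof. by move=> _ [s _ <-]; exact: circle_wrap. Qed.

Lemma piece_open_arc U x : open [set r | U (wrap r)] -> circle x -> U x ->
  open_arc (piece U x).
Proof.
move=> oU cx Ux; exists (comp U x); split => //.
- exact: comp_open.
- exact: comp_itv.
- by exists x; apply: comp_refl; rewrite wrap_id.
Qed.

Lemma piece_basic U x : U `<=` circle -> open [set r | U (wrap r)] -> U x ->
  basic_interval U (piece U x).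
Proof.
move=> Uc oU Ux; exists (piece U @` U); last by exists x.
split.
- by move=> _ [y Uy <-]; apply: piece_open_arc => //; exact: Uc.
- move=> _ _ [y Uy <-] [z Uz <-] [w [yw zw]].
  by rewrite -(piece_eq yw) -(piece_eq zw).
- apply/seteqP; split=> y; first by move=> [_ [z _ <-]]; exact: piece_sub.
  by move=> Uy; exists (piece U y); [exists y|apply: piece_mem => //; exact: Uc].
Qed.

Lemma cell_full s : cell s (s + 2 * pi) = circle.
Proof.
apply/seteqP; split=> [|y cy]; first exact: cell_circle.
have := circle_wrap (y - s); rewrite /circle/= in_itv/= => /andP[h1 h2].
exists (s + wrap (y - s)); first by rewrite /= in_itv/=; apply/andP; split; lra.
have [k ->] := wrapE (y - s); rewrite -{2}(wrap_id cy) -(wrapD y k).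
by congr wrap; rewrite addrA [s + _]addrC subrK.
Qed.

(** If the component on the line contains two points at distance [2 * pi], the piece is the whole
    circle. Otherwise the component is a bounded open interval and the only point of the half-open
    cell that can be missing is the image of its left end. *)
Lemma piece_cell U x : open [set r | U (wrap r)] -> circle x -> U x ->
  exists a b z, [/\ a < b, b <= a + 2 * pi, piece U x `<=` cell a b &
    cell a b `<=` piece U x `|` [set z]].
Proof.
move=> oU cx Ux; have p0 : 0 < pi :> R by exact: pi_gt0.
have oJ := comp_open (t := x) oU; have iJ := @comp_itv U x.
have xJ : comp U x x by apply: comp_refl; rewrite wrap_id.
have [[s [sJ sJ']]|nJ] := pselect (exists s, comp U x s /\ comp U x (s + 2 * pi)).
  exists s, (s + 2 * pi), 0; split => //; [lra|by rewrite cell_full; exact: piece_circle|].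
  move=> _ [t /= + <-]; rewrite in_itv/= => /andP[st ts]; left; exists t => //.
  by apply: (iJ _ _ sJ sJ'); rewrite st ltW.
have lbJ : lbound (comp U x) (x - 2 * pi).
  move=> s sJ; rewrite leNgt; apply/negP => sx; apply: nJ; exists (x - 2 * pi).
  by split; [apply: (iJ _ _ sJ xJ)|rewrite subrK]; rewrite // ltW//=; lra.
have ubJ : ubound (comp U x) (x + 2 * pi).
  move=> s sJ; rewrite leNgt; apply/negP => sx; apply: nJ; exists x.
  by split => //; apply: (iJ _ _ xJ sJ); rewrite [X in _ && X]ltW// andbT; lra.
have hl : has_lbound (comp U x) by exists (x - 2 * pi).
have hu : has_ubound (comp U x) by exists (x + 2 * pi).
have := interval_bounded_interior iJ hl hu.
have /interior_id -> := oJ.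
set a := inf _; set b := sup _ => JE.
have [ax xb] : a < x /\ x < b by apply/andP; move: xJ; rewrite JE.
exists a, b, (wrap a); split; first exact: lt_trans xb.
(* In a longer interval the points at distance [pi] on either side of the midpoint would be the
   excluded pair. *)
- rewrite leNgt; apply/negP => ba; apply: nJ; exists ((a + b) / 2 - pi).
  by rewrite JE /=; split; apply/andP; split; lra.
- move=> _ [t /= + <-]; rewrite JE/= => /andP[at_ tb].
  by exists t; rewrite //= in_itv/= ltW.
- move=> _ [t /= + <-]; rewrite in_itv/= le_eqVlt => /andP[/predU1P[<-|at_] tb].
    by right.
  by left; exists t => //; rewrite JE /= at_.
Qed.

Lemma measurable_piece U x : open [set r | U (wrap r)] -> circle x -> U x ->
  measurable (piece U x : set (lebR R)).
Proof.
move=> oU cx Ux; have [a [b [z [ab ba s1 s2]]]] := piece_cell oU cx Ux.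
have mc : measurable (cell a b : set (lebR R)) by exact: measurable_cell.
have mz : measurable ([set z] : set (lebR R)) by exact: borel_lebR.
have [pz|npz] := pselect (piece U x z).
  rewrite (_ : piece U x = cell a b)//; apply/seteqP; split => // y /s2[//|->//].
rewrite (_ : piece U x = cell a b `\` [set z]); first exact: measurableD.
apply/seteqP; split => [y py|y [/s2[]//]]; split; first exact: s1.
by move=> yz; apply: npz; rewrite -yz.
Qed.

(** Every component on the line is open and contains a rational, so enumerating the rationals lists
    all pieces. *)
Lemma pieces_enum U : U `<=` circle -> open [set r | U (wrap r)] ->
  exists F : nat -> set R, [/\ trivIset setT F, \bigcup_n F n = U &
    forall n, F n = set0 \/ exists2 x, U x & F n = piece U x].
Proof.
move=> Uc oU.
have [e esurj] : exists e : nat -> option rat, forall q, exists n, e n = Some q.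
  by exists unpickle => q; exists (pickle q); rewrite pickleK.
pose G (n : nat) : set R := if e n is Some q then
  (if `[< U (wrap (ratr q)) >] then piece U (wrap (ratr q)) else set0) else set0.
have GP n : G n = set0 \/ exists2 x, U x & G n = piece U x.
  rewrite /G; case: (e n) => [q|]; last by left.
  by case: asboolP => Uq; [right; exists (wrap (ratr q))|left].
exists (seqDU G); split; first exact: trivIset_seqDU.
- rewrite -seqDU_bigcup_eq; apply/seteqP; split => [y [n _]|y Uy].
    by case: (GP n) => [->//|[x _ ->]]; exact: piece_sub.
  have oJ := comp_open (t := y) oU.
  have yJ : comp U y y by apply: comp_refl; rewrite wrap_id//; exact: Uc.
  have /nbhs_ballP[d /= d0 dJ] : nbhs y (comp U y) by exact: open_nbhs_nbhs.
  have /rat_in_itvoo[q] : y < y + d by rewrite ltrDl.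
  rewrite in_itv/= => /andP[yq qy].
  have qJ : comp U y (ratr q).
    by apply: dJ; rewrite /ball/= ltr_norml; apply/andP; split; lra.
  have [n en] := esurj q; exists n => //; rewrite /G en asboolT; last exact: comp_sub qJ.
  rewrite piece_wrap /piece (comp_eq qJ); apply: piece_mem => //; exact: Uc.
- move=> n; rewrite /seqDU; case: (GP n) => [->|[x Ux Gx]]; first by left; rewrite set0D.
  (* Pieces that meet coincide, so subtracting the earlier ones either empties a piece or leaves it
     intact. *)
  have [[i [iltn [y [Giy Gny]]]]|H] :=
    pselect (exists i, (i < n)%N /\ exists y, G i y /\ G n y).
    left; rewrite -subset0 => w [Gnw]; apply.
    rewrite -bigcup_mkord; exists i => //=.
    case: (GP i) => [Gi|[x' _ Gi]]; first by rewrite Gi in Giy.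
    by rewrite Gi -(piece_eq (y := y)) -?Gi// (piece_eq (x := x)) -?Gx.
  right; exists x => //; rewrite Gx; apply/seteqP; split => [w []//|w pw].
  split => //; rewrite -bigcup_mkord => -[i /= iltn Giw]; apply: H.
  by exists i; split => //; exists w; rewrite Gx.
Qed.

(** [X] contains every piece of [U] based at one of its points, so its intersection with [U] is a
    countable disjoint union of pieces and the inequality can be summed. *)
Lemma measure_pieces_le (mu nu : {measure set (lebR R) -> \bar R}) (X U : set R) :
  U `<=` circle -> open [set r | U (wrap r)] ->
  (forall x, U x -> X x -> piece U x `<=` X) ->
  (forall x, U x -> X x -> (mu (piece U x) <= nu (piece U x))%E) ->
  (mu (X `&` U) <= nu (X `&` U))%E.
Proof.
move=> Uc oU XU H; have [F [tF UF FP]] := pieces_enum Uc oU.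
pose G n := X `&` F n.
have GP n : G n = set0 \/ exists x, [/\ U x, X x & G n = piece U x].
  case: (FP n) => [F0|[x Ux Fx]]; first by left; rewrite /G F0 setI0.
  have [[y [Xy Fy]]|GE] := pselect (exists y, X y /\ F n y); last first.
    by left; rewrite -subset0 => y [Xy Fy]; apply: GE; exists y.
  right; exists y; rewrite Fx in Fy; have Uy := piece_sub Fy.
  split => //; rewrite /G Fx -(piece_eq Fy); apply/setIidr; exact: XU.
have mG n : measurable (G n : set (lebR R)).
  case: (GP n) => [->//|[x [Ux _ ->]]]; apply: measurable_piece => //; exact: Uc.
have tG : trivIset setT G.
  by apply/trivIsetP => i j _ _ ij; move/trivIsetP : tF => /(_ i j I I ij) Fij;
    rewrite /G setIACA Fij setI0.
have UG : X `&` U = \bigcup_n G n by rewrite -UF setI_bigcupr.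
have mUG : measurable (\bigcup_n G n : set (lebR R)) by exact: bigcupT_measurable.
rewrite UG !measure_semi_bigcup//; apply: lee_nneseries => // n _.
by case: (GP n) => [->|[x [Ux Xx ->]]]; [rewrite !measure0|exact: H].
Qed.

Lemma level_open (f : R -> R) l : circle_lower_semicontinuous f ->
  open [set r | [set x | circle x /\ l < f x] (wrap r)].
Proof.
move=> /lower_semicontinuousP /(_ l); rewrite (_ : [set r | _ (wrap r)] =
  [set x | (l%:E < (f (wrap x))%:E)%E])//.
apply/seteqP; split => t /=; rewrite lte_fin; first by case.
by split => //; exact: circle_wrap.
Qed.

Lemma open_wrap_measurable U : U `<=` circle -> open [set r | U (wrap r)] ->
  measurable (U : set (lebR R)).
Proof.
move=> Uc oU; rewrite (_ : U = circle `&` [set r | U (wrap r)]).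
  by apply: measurableI; [exact: circle_lebR|exact: open_lebR].
by apply/seteqP; split => [x Ux|x [cx]] /=; [have cx := Uc _ Ux|]; rewrite wrap_id.
Qed.

Lemma lsc_measurable (f : R -> R) : circle_lower_semicontinuous f ->
  circle_measurable f.
Proof.
move=> lf; apply: circle_measurable_gtP => c.
by apply: open_wrap_measurable; [move=> x []|exact: level_open].
Qed.

End pieces.

(** * Level measures on arcs up to one point *)

Section arclike_sets.
Variable R : realType.

(* An arc up to one point. *)
Definition arclike (I : set R) := measurable (I : set (lebR R)) /\
  exists a b z, [/\ a < b, b <= a + 2 * pi, I `<=` cell a b &
    cell a b `<=` I `|` [set z]].

Lemma piece_arclike (U : set R) x : open [set r | U (wrap r)] -> circle x -> U x ->
  arclike (piece U x).
Proof. by move=> oU cx Ux; split; [exact: measurable_piece|exact: piece_cell]. Qed.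

Lemma arclike_measure (nu : {measure set (lebR R) -> \bar R}) (I J : set R) z :
  (forall x, nu [set x] = 0%E) -> measurable (I : set (lebR R)) ->
  measurable (J : set (lebR R)) -> I `<=` J -> J `<=` I `|` [set z] -> nu J = nu I.
Proof.
move=> nu1 mI mJ IJ JI; have mz : measurable ([set z] : set (lebR R)).
  exact: borel_lebR.
apply/eqP; rewrite eq_le; apply/andP; split; last by rewrite le_measure ?inE.
rewrite -(measureU0 mI mz (nu1 z)) le_measure ?inE//; exact: measurableU.
Qed.

Variable Phi : R -> R -> R.
Hypothesis mf : modular_family Phi.
Hypothesis ainf : A_infty Phi.

Local Notation mu l := (dens (level mf l)).

(** The A_infty property with bound 1 applies to all subcells at once, because their mass is at most
    that of the cell; [e] and [d] do not depend on the level. *)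
Lemma controlled_level : exists e d, [/\ 0 < e, e < 1, 0 < d & d < 1] /\
  forall l a b, 0 < l -> a < b -> b <= a + 2 * pi -> (mu l (cell a b) <= 1)%E ->
  controlled (mu l) e d a b.
Proof.
have [e [d [/andP[e0 e1] /andP[d0 d1] H]]] := ainf ltr01.
exists e, d; split => // l a b l0 ab ba mu1 a' b' aa ab' bb E mE EI mEd.
have mI : measurable (cell a b : set (lebR R)) by exact: measurable_cell.
have ba' : b' <= a' + 2 * pi by lra.
have mI' : measurable (cell a' b' : set (lebR R)) by exact: measurable_cell.
have muI' : (mu l (cell a' b') <= 1)%E.
  by apply: le_trans mu1; rewrite le_measure ?inE//; exact: cell_sub.
have fI' : mu l (cell a' b') \is a fin_num.
  by rewrite ge0_fin_numE// (le_lt_trans muI')// ltry.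
have muE : (mu l E <= mu l (cell a' b'))%E by rewrite le_measure ?inE.
have fE : mu l E \is a fin_num.
  by rewrite ge0_fin_numE// (le_lt_trans (le_trans muE muI'))// ltry.
have fmE : arclength E \is a fin_num.
  rewrite ge0_fin_numE//; apply: (@le_lt_trans _ _ (arclength (cell a' b'))).
    by rewrite le_measure ?inE.
  by rewrite arclength_cell ?ltry// ltW.
have := H l (cell a' b') l0 (@cell_arc _ _ _).
rewrite level_measureE ?(ltW l0)//; last exact: cell_circle.
move=> /(_ muI' E mE EI); rewrite arclength_cell ?(ltW ab')// -(fineK fmE) -EFinM lte_fin.
move=> /(_ mEd); rewrite level_measureE ?(ltW l0)//; last first.
  by apply: subset_trans EI _; exact: cell_circle.
by rewrite -lee_fin EFinM !fineK// => /ltW.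
Qed.

Lemma level_upper eps : 0 < eps -> exists2 th, 0 < th &
  forall l I, 0 < l -> arclike I -> (mu l I <= 1)%E ->
  forall E, measurable (E : set (lebR R)) -> E `<=` I ->
  (arclength E <= th%:E * arclength I)%E -> (mu l E <= eps%:E * mu l I)%E.
Proof.
have [e [d [[e0 e1 d0 d1] ctl]]] := controlled_level.
move=> eps0; have [th th0 H] := controlled_upper e0 e1 d0 d1 eps0.
exists th => // l I l0 [mI [a [b [z [ab ba Ic cI]]]]] mu1 E mE EI.
have mc : measurable (cell a b : set (lebR R)) by exact: measurable_cell.
have nu1 := @dens_set1 R (level mf l).
have muc : mu l (cell a b) = mu l I := arclike_measure nu1 mI mc Ic cI.
have ac : arclength (cell a b) = arclength I :=
  arclike_measure (@arclength_set1 R) mI mc Ic cI.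
have EIc : E `<=` cell a b by exact: subset_trans Ic.
have fc : (mu l (cell a b) < +oo)%E by rewrite muc (le_lt_trans mu1)// ltry.
have fE : mu l E \is a fin_num.
  by rewrite ge0_fin_numE// (le_lt_trans _ fc)// le_measure ?inE.
rewrite -ac -muc arclength_cell ?(ltW ab)// => mEth.
have fmE : arclength E \is a fin_num.
  by rewrite ge0_fin_numE// (le_lt_trans mEth)// -EFinM ltry.
have c1 : controlled (mu l) e d a b by apply: ctl => //; rewrite muc.
have := H _ a b ab ba fc nu1 c1 E mE EIc.
rewrite -lee_fin fineK// EFinM => /(_ mEth).
by rewrite -lee_fin EFinM !fineK// ge0_fin_numE.
Qed.

Lemma level_lower eta : 0 < eta -> exists2 c, 0 < c &
  forall l I, 0 < l -> arclike I -> (mu l I <= 1)%E ->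
  forall E, measurable (E : set (lebR R)) -> E `<=` I ->
  (eta%:E * arclength I <= arclength E)%E -> (c%:E * mu l I <= mu l E)%E.
Proof.
have [e [d [[e0 e1 d0 d1] ctl]]] := controlled_level.
move=> eta0; have [c c0 H] := controlled_lower e0 e1 d0 d1 eta0.
exists c => // l I l0 [mI [a [b [z [ab ba Ic cI]]]]] mu1 E mE EI.
have mc : measurable (cell a b : set (lebR R)) by exact: measurable_cell.
have nu1 := @dens_set1 R (level mf l).
have muc : mu l (cell a b) = mu l I := arclike_measure nu1 mI mc Ic cI.
have ac : arclength (cell a b) = arclength I :=
  arclike_measure (@arclength_set1 R) mI mc Ic cI.
have EIc : E `<=` cell a b by exact: subset_trans Ic.
have fc : (mu l (cell a b) < +oo)%E by rewrite muc (le_lt_trans mu1)// ltry.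
have fE : mu l E \is a fin_num.
  by rewrite ge0_fin_numE// (le_lt_trans _ fc)// le_measure ?inE.
rewrite -ac -muc arclength_cell ?(ltW ab)// => mEth.
have fmE : arclength E \is a fin_num.
  rewrite ge0_fin_numE//; apply: (@le_lt_trans _ _ (arclength (cell a b))).
    by rewrite le_measure ?inE.
  by rewrite arclength_cell ?ltry// ltW.
have c1 : controlled (mu l) e d a b by apply: ctl => //; rewrite muc.
have := H _ a b ab ba fc nu1 c1 E mE EIc.
rewrite -lee_fin fineK// EFinM => /(_ mEth).
by rewrite -lee_fin EFinM !fineK// ge0_fin_numE.
Qed.

(** A comparison across levels: by the contrapositive of [level_lower], small mass at level [l']
    means small length, and [level_upper] turns this into small mass at the lower level [l]. *)
Lemma level_small eps : 0 < eps -> exists2 c, 0 < c &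
  forall l l' I, 0 < l -> l <= l' -> arclike I -> (mu l' I <= 1)%E ->
  forall E, measurable (E : set (lebR R)) -> E `<=` I ->
  (mu l' E < c%:E * mu l' I)%E -> (mu l E <= eps%:E * mu l I)%E.
Proof.
move=> eps0; have [th th0 Hth] := level_upper eps0.
have [c c0 Hc] := level_lower th0; exists c => // l l' I l0 ll' aI mu1 E mE EI h.
have l'0 : 0 < l' by exact: lt_le_trans ll'.
apply: Hth => //.
  apply: le_trans mu1; apply: dens_le => [|x cx _]; first by case: aI.
  by apply: Phi_le => //; rewrite !gtr0_norm.
rewrite leNgt; apply/negP => /ltW /(Hc _ _ l'0 aI mu1 _ mE EI).
by rewrite leNgt h.
Qed.

End arclike_sets.

(** * The good-lambda argument *)

(** The right-hand side is itself the measure of the density [lin_weight], and the left one a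
    restriction, so two measures are compared piece by piece. *)
Lemma dens_pieces_le (R : realType) (k1 k2 : R) (w w1 w2 : weight R) (B X U : set R) :
  0 <= k1 -> 0 <= k2 -> measurable (B : set (lebR R)) ->
  U `<=` circle -> open [set r | U (wrap r)] -> measurable (X : set (lebR R)) ->
  (forall x, U x -> X x -> piece U x `<=` X) ->
  (forall x, U x -> X x -> (dens w (piece U x `&` B) <=
     k1%:E * dens w1 (piece U x) + k2%:E * dens w2 (piece U x))%E) ->
  (dens w (X `&` U `&` B) <= k1%:E * dens w1 (X `&` U) + k2%:E * dens w2 (X `&` U))%E.
Proof.
move=> k10 k20 mB Uc oU mX XU H.
rewrite -dens_lin//; last by apply: measurableI => //; exact: open_wrap_measurable.
apply: (@measure_pieces_le R (mrestr (dens w) mB) (dens (lin_weight k1 k2 w1 w2)) X U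
  Uc oU XU) => x Ux Xx.
apply: (le_trans (H x Ux Xx)); rewrite -dens_lin//.
by apply: measurable_piece => //; exact: Uc.
Qed.

(** The budget of the induction step. The terms [u1] and [xe] each use a quarter of [C * a]. In the
    first alternative [xh] is at most [2 * (gh' - gh)] and is paid by the charges; in the second it
    uses another quarter. *)
Lemma step_bound (R : realFieldType) (C k a xe xh ge gh ge' gh' xh' gi u1 u2 : R) :
  0 <= C -> 0 <= a -> C * a = 4 * k -> u1 <= k ->
  u2 <= C * (xe + xh) + 2 * C * (ge + gh) ->
  xe <= 4^-1 * a -> ge <= ge' -> gh <= gh' -> ge' + gh' <= gi ->
  xh + gh <= xh' + gh' -> 2 * xh' <= xh \/ xh <= 4^-1 * a ->
  u1 + u2 <= C * a + 2 * C * gi.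
Proof.
move=> C0 a0 Ca u1k u2k xea ge_ gh_ gi_ gain H.
have Ca0 : 0 <= C * a by exact: mulr_ge0.
have h1 := ler_wpM2l C0 xea; have h2 := ler_wpM2l C0 ge_.
have h3 := ler_wpM2l C0 gi_; have h4 := ler_wpM2l C0 gain.
have h5 := ler_wpM2l C0 gh_.
case: H => /(ler_wpM2l C0) h6; lra.
Qed.

Section good_lambda_step.
Variables (R : realType) (Phi : R -> R -> R).
Hypothesis mf : modular_family Phi.
Variables (K b : R).
Hypothesis K1 : 1 <= K.
Hypothesis b1 : 1 < b.
Hypothesis dbl : forall x t, circle x -> 0 <= t -> Phi x (b * t) <= K * Phi x t.
Variables (f g : R -> R).
Hypothesis lf : circle_lower_semicontinuous f.
Hypothesis f0 : forall x, circle x -> 0 <= f x.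
Hypothesis mg : circle_measurable g.
Variables (l0 gam c M : R).
Hypothesis l0_gt0 : 0 < l0.
Hypothesis gam_gt0 : 0 < gam.
Hypothesis c_gt0 : 0 < c.
Hypothesis c_le2 : c <= 2.
(** With this growth factor, [mu i H < 2 mu j H] and [r mu j I <= mu i I] give [mu i H < c mu i I].
    The hypothesis on [K * r * M] keeps all masses involved below 1. *)
Let r := 2 / c.
Hypothesis KrM : K * r * M <= 1.

Let mfm : circle_measurable f := lsc_measurable lf.
(** Scaled so that [|g x| >= gam * lam j] reads [|gp x| >= lam j.+1]. *)
Let gp x := b / gam * g x.
Let mgp : circle_measurable gp := circle_measurableZ (b / gam) mg.
Let lam j := l0 * b ^+ j.
Let U j := [set x | circle x /\ lam j < f x].
Let L j := [set x | circle x /\ f x <= lam j].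
Let bad j := [set x | [/\ circle x, lam j.+1 < f x & `|g x| < gam * lam j]].

Local Notation rho := (dens (Phi_weight mf mfm)).
Local Notation rhog := (dens (Phi_weight mf mgp)).
Local Notation mu j := (dens (level mf (lam j))).
Local Notation mb A := (measurable (A : set (lebR R))).

Hypothesis rhoM : (rho circle <= M%:E)%E.
Hypothesis rhog_fin : (rhog circle < +oo)%E.
Variable th : R.
Hypothesis Hbad : forall j x, U j x ->
  (arclength (piece (U j) x `&` bad j) <= th%:E * arclength (piece (U j) x))%E.
Hypothesis Hth : forall l I, 0 < l -> arclike I -> (dens (level mf l) I <= 1)%E ->
  forall E, mb E -> E `<=` I -> (arclength E <= th%:E * arclength I)%E ->
  (dens (level mf l) E <= (4 * K * r)^-1%:E * dens (level mf l) I)%E.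
Hypothesis Hsmall : forall i j x, (j < i)%N -> U j x ->
  (mu i (piece (U j) x) <= 1)%E -> forall H, mb H -> H `<=` piece (U j) x ->
  (mu i H < c%:E * mu i (piece (U j) x))%E ->
  (mu j H <= (8^-1)%:E * mu j (piece (U j) x))%E.

Let r_ge1 : 1 <= r.
Proof. by rewrite /r ler_pdivlMr// mul1r. Qed.

Let K_gt0 : 0 < K. Proof. exact: lt_le_trans K1. Qed.

Let r_gt0 : 0 < r. Proof. exact: lt_le_trans r_ge1. Qed.

Let C1_gt0 : 0 < 4 * K * r. Proof. by apply: mulr_gt0 => //; apply: mulr_gt0. Qed.

Let lam_gt0 j : 0 < lam j.
Proof. by rewrite mulr_gt0// exprn_gt0// (lt_trans _ b1). Qed.

Let lam_le i j : (i <= j)%N -> lam i <= lam j.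
Proof. by move=> ij; rewrite ler_pM2l// ler_weXn2l// ltW. Qed.

Let normlam j : `|lam j| = lam j. Proof. by rewrite gtr0_norm. Qed.

Let lamS j : lam j.+1 = b * lam j. Proof. by rewrite /lam exprS mulrCA. Qed.

Let U_circle j : U j `<=` circle. Proof. by move=> x []. Qed.

Let U_open j : open [set t | U j (wrap t)]. Proof. exact: level_open. Qed.

Let mU j : mb (U j). Proof. by apply: open_wrap_measurable. Qed.

Let U_mono i j : (i <= j)%N -> U j `<=` U i.
Proof. by move=> ij x [cx fx]; split => //; exact: le_lt_trans (lam_le ij) fx. Qed.

Let mpiece j x : U j x -> mb (piece (U j) x).
Proof. by move=> Ux; apply: measurable_piece => //; exact: U_circle Ux. Qed.

Let mL j : mb (L j).
Proof.
rewrite (_ : L j = circle `\` U j).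
  by apply: measurableD => //; exact: circle_lebR.
apply/seteqP; split=> x /= [cx]; first by move=> fx; split => // -[_]; rewrite ltNge fx.
by move=> nU; split => //; rewrite leNgt; apply/negP => fx; apply: nU.
Qed.

Let mbad j : mb (bad j).
Proof.
rewrite (_ : bad j = U j.+1 `&` (circle `\` [set x | circle x /\ gam * lam j <= `|g x|])).
  apply: measurableI => //; apply: measurableD; first exact: circle_lebR.
  by apply: circle_measurable_ge; exact: circle_measurable_norm.
apply/seteqP; split=> x /=.
  by move=> [cx fx gx]; split => //; split => // -[_]; rewrite leNgt gx.
move=> [[cx fx] [_ ng]]; split => //; rewrite ltNge; apply/negP => gx.
by apply: ng.
Qed.

Let gw_fun j x := Num.max (Phi x `|gp x| - Phi x `|lam j|) 0.

Let gw_ge0 j x : circle x -> 0 <= gw_fun j x.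
Proof. by move=> _; rewrite le_max lexx orbT. Qed.

Let gw_measurable j : circle_measurable (gw_fun j).
Proof.
apply: measurable_maxr; last exact: measurable_cst.
apply: measurable_funB; first exact: (wfun_measurable (Phi_weight mf mgp)).
exact: (wfun_measurable (level mf (lam j))).
Qed.

(* Charging only the part of [Phi x (b |g x| / gam)] above the level [lam j]
   makes the charges along nested pieces telescope. *)
Let gw j := Weight (@gw_ge0 j) (gw_measurable j).

Local Notation G j := (dens (gw j)).

Let mu_le_rho j A : mb A -> A `<=` U j -> (mu j A <= rho A)%E.
Proof.
move=> mA AU; apply: dens_le => // x cx /AU[_ fx] /=.
by apply: Phi_le => //; rewrite normlam (le_trans (ltW fx))// ler_norm.
Qed.

Let rho_le A : mb A -> A `<=` circle -> (rho A <= M%:E)%E.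
Proof.
by move=> mA Ac; apply: le_trans rhoM; rewrite le_measure ?inE//; exact: circle_lebR.
Qed.

Let muS j A : mb A -> (mu j.+1 A <= K%:E * mu j A)%E.
Proof.
move=> mA; apply: dens_leZ => //; first by rewrite (le_trans _ K1).
by move=> x cx _ /=; rewrite !normlam lamS; apply: dbl => //; exact: ltW.
Qed.

Let G_mono i j A : (i <= j)%N -> mb A -> (G j A <= G i A)%E.
Proof.
move=> ij mA; apply: dens_le => // x cx _ /=; rewrite /gw_fun ge_max le_max.
rewrite [X in _ && X]le_max lexx orbT andbT lerD2l lerN2.
by rewrite Phi_le// !normlam lam_le.
Qed.

Let G_fin j A : mb A -> A `<=` circle -> G j A \is a fin_num.
Proof.
move=> mA Ac; rewrite ge0_fin_numE//; apply: le_lt_trans rhog_fin.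
apply: (@le_trans _ _ (rhog A)); last first.
  by rewrite le_measure ?inE//; exact: circle_lebR.
apply: dens_le => // x cx _ /=; rewrite /gw_fun ge_max Phi_ge0// andbT.
by rewrite lerBlDr lerDl Phi_ge0.
Qed.

Let fin_le A B (nu : {measure set (lebR R) -> \bar R}) (z : R) :
  mb A -> mb B -> A `<=` B -> (nu B <= z%:E)%E -> nu A \is a fin_num.
Proof.
move=> mA mB AB nuB; rewrite ge0_fin_numE//.
by rewrite (le_lt_trans _ (ltry z))// (le_trans _ nuB)// le_measure ?inE.
Qed.

Let Hgood j x : U j x ->
  (mu j (piece (U j) x `&` bad j) <= (4 * K * r)^-1%:E * mu j (piece (U j) x))%E.
Proof.
move=> Ux; have mp := mpiece Ux; have cx := U_circle Ux.
apply: Hth => //; [exact: piece_arclike| |exact: measurableI|exact: Hbad].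
apply: (le_trans (mu_le_rho mp (@piece_sub _ _ _))).
apply: (le_trans (rho_le mp (@piece_circle _ _ _))); rewrite lee_fin.
have M0 : 0 <= M by rewrite -lee_fin (le_trans _ rhoM).
apply: le_trans KrM; rewrite ler_peMl// -[1]mulr1.
by apply: ler_pM.
Qed.

Let nested i j x : (j <= i)%N -> U j x ->
  forall y, U i y -> piece (U j) x y -> piece (U i) y `<=` piece (U j) x.
Proof.
move=> ji Ux y Uy xy; rewrite -(piece_eq xy); apply: piece_mono; exact: U_mono.
Qed.

(** The estimate [Hgood] summed over the pieces of level [i] inside one piece of level [j]. *)
Let bad_le i j x : (j <= i)%N -> U j x ->
  (mu i (piece (U j) x `&` U i `&` bad i) <=
   (4 * K * r)^-1%:E * mu i (piece (U j) x `&` U i))%E.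
Proof.
move=> ji Ux; have k0 : 0 <= (4 * K * r)^-1.
  by rewrite invr_ge0 ltW.
have mX : mb (piece (U j) x `&` U i) by apply: measurableI => //; exact: mpiece.
have := @dens_pieces_le R (4 * K * r)^-1 0 (level mf (lam i)) (level mf (lam i))
  (level mf (lam i)) (bad i) (piece (U j) x) (U i) k0 (lexx _) (mbad i) (@U_circle i)
  (@U_open i) (mpiece Ux) (nested ji Ux).
rewrite mul0e adde0; apply => y Uy xy.
by rewrite mul0e adde0; exact: Hgood.
Qed.

Let C1 := 4 * K * r.

(* Induction on the number [n] of remaining levels. The level [i] is the first
   one at which the mass of the piece [I] has grown by the factor [r]. On the
   part [H] of [I] that the good-lambda inequality leaves out, either
   [mu j H] is at most half of [mu i H], and the increment of [G] pays for
   [mu i H]; or [mu i H] is a small fraction of [mu i I], hence [H] is short,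
   hence [mu j H] is a small fraction of [mu j I]. *)
Lemma piece_bound n j x : U j x ->
  (rho (piece (U j) x `&` L (j + n)) <=
   C1%:E * mu j (piece (U j) x) + (2 * C1)%:E * G j (piece (U j) x))%E.
Proof.
elim/ltn_ind: n j x => n IH j x Ux; set I := piece (U j) x; set N := (j + n)%N.
have mI : mb I by exact: mpiece.
have IU : I `<=` U j by exact: piece_sub.
have Ic : I `<=` circle by exact: piece_circle.
have K0 : 0 < K by rewrite (lt_le_trans _ K1).
have r0 : 0 < r by rewrite (lt_le_trans _ r_ge1).
have C0 : 0 < C1 by rewrite /C1 mulr_gt0// mulr_gt0.
have muM : (mu j I <= M%:E)%E by rewrite (le_trans (mu_le_rho mI IU))// rho_le.
have fa : mu j I \is a fin_num by exact: (fin_le mI mI (subset_refl _) muM).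
have fG := G_fin j mI Ic.
set a := fine (mu j I); have aE : mu j I = a%:E by rewrite /a fineK.
have a0 : 0 <= a by rewrite -lee_fin -aE.
have gI0 : 0 <= fine (G j I) by rewrite fine_ge0.
have mIL : mb (I `&` L N) by exact: measurableI.
have rho_mu i A : mb A -> A `<=` L i -> (rho A <= mu i A)%E.
  move=> mA AL; apply: dens_le => // y cy /AL[_ fy] /=.
  by apply: Phi_le => //; rewrite normlam ger0_norm// f0.
(* If the mass never grows by the factor [r] up to level [N], then [mu N I] alone bounds the
   integral. *)
have [[i0 i0P]|nex] := pselect (exists i, (j < i <= N)%N /\ (r%:E * mu j I <= mu i I)%E);
  last first.
  have h1 : (rho (I `&` L N) <= mu N I)%E.
    apply: le_trans (rho_mu N _ mIL _) _; first by move=> y [].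
    by rewrite le_measure ?inE//; exact: subIsetl.
  have h2 : (mu N I <= r%:E * mu j I)%E.
    have [jN|] := ltnP j N.
      rewrite leNgt; apply/negP => h; apply: nex; exists N; rewrite jN leqnn.
      by split => //; exact: ltW.
    rewrite /N -[leqRHS]addn0 leq_add2l leqn0 => /eqP ->.
    by rewrite addn0 aE -EFinM lee_fin ler_peMl.
  apply: (le_trans h1); apply: (le_trans h2); rewrite aE -(fineK fG) -!EFinM -EFinD lee_fin.
  have : r * a <= C1 * a.
    rewrite ler_wpM2r// /C1; have : r <= K * r by rewrite ler_peMl// ltW.
    by lra.
  have : 0 <= 2 * C1 * fine (G j I) by rewrite mulr_ge0// mulr_ge0// ltW.
  by lra.
(* For the first such level [i], the level below still has mass at most [r mu j I], so one doubling
   step bounds [mu i I] by [K * r] times [mu j I]. *)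
pose P i := `[< (j < i <= N)%N /\ (r%:E * mu j I <= mu i I)%E >].
have exP : exists i, P i by exists i0; apply/asboolP.
case: (ex_minnP exP) => -[|i'] /asboolP[/andP[ji iN] muiI] min; first by [].
set i := i'.+1 in ji iN muiI.
have ji' : (j <= i')%N by [].
have mui' : (mu i' I <= r%:E * mu j I)%E.
  have [->|ne] := eqVneq i' j; first by rewrite aE -EFinM lee_fin ler_peMl.
  rewrite leNgt; apply/negP => h; suff : (i <= i')%N by rewrite ltnn.
  apply: min; apply/asboolP; split; last exact: ltW.
  by rewrite ltn_neqAle eq_sym ne ji' (leq_trans _ iN)// leqnSn.
have mui : (mu i I <= (K * r)%:E * mu j I)%E.
  by apply: (le_trans (muS i' mI)); rewrite EFinM -muleA lee_wpmul2l// lee_fin ltW.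
have mui1 : (mu i I <= 1)%E.
  apply: (le_trans mui); apply: (@le_trans _ _ ((K * r)%:E * M%:E)%E).
    by rewrite lee_wpmul2l// lee_fin mulr_ge0// ltW.
  by rewrite -EFinM lee_fin.
set X := I `&` U i; have mX : mb X by exact: measurableI.
have XI : X `<=` I by exact: subIsetl.
set E := X `&` bad i'; have mE : mb E by exact: measurableI.
set H := X `\` bad i'; have mH : mb H by exact: measurableD.
have EI : E `<=` I by move=> y [/XI].
have HI : H `<=` I by move=> y [/XI].
have EH : E `&` H = set0.
  by apply/seteqP; split => // y [[_ ?] [_ ?]].
have XEH : X = E `|` H.
  apply/seteqP; split=> y; last by case=> -[].
  by move=> Xy; have [?|?] := pselect (bad i' y); [left|right].
have splitX (nu : {measure set (lebR R) -> \bar R}) : nu X = (nu E + nu H)%E.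
  by rewrite XEH measureU.
have F1 : (rho ((I `&` L N) `\` U i) <= (K * r)%:E * mu j I)%E.
  have mD : mb ((I `&` L N) `\` U i) by exact: measurableD.
  apply: le_trans mui; apply: (le_trans (rho_mu i _ mD _)).
    by move=> y [[/Ic cy _] nU]; split => //; rewrite leNgt; apply/negP => fy; apply: nU.
  by rewrite le_measure ?inE// => y [[]].
(* The induction hypothesis on the pieces of level [i] inside [I], with [N - i] levels remaining. *)
have F2 : (rho ((I `&` L N) `&` U i) <= C1%:E * mu i X + (2 * C1)%:E * G i X)%E.
  rewrite setIAC; apply: dens_pieces_le => //; try exact: ltW.
  - by rewrite mulr_ge0// ltW.
  - exact: nested (ltnW ji) Ux.
  move=> y Uy xy.
  have Nm : N = (i + (N - i))%N by rewrite subnKC.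
  rewrite {1}Nm; apply: IH => //.
  by rewrite ltn_subLR// ltn_add2r.
have rhoF : rho (I `&` L N) = (rho ((I `&` L N) `\` U i) + rho ((I `&` L N) `&` U i))%E.
  exact: measureDI.
(* The good-lambda inequality is used one level below [i]. *)
have muE : (mu i E <= (4^-1)%:E * mu j I)%E.
  apply: (le_trans (muS i' mE)).
  have E' : E `<=` I `&` U i' `&` bad i'.
    by move=> y [[Iy Uy] by_]; split => //; split => //; apply: U_mono Uy; exact: leqnSn.
  have mI' : mb (I `&` U i') by exact: measurableI.
  have h1 : (mu i' E <= (4 * K * r)^-1%:E * (r%:E * mu j I))%E.
    apply: (@le_trans _ _ (mu i' (I `&` U i' `&` bad i'))).
      by rewrite le_measure ?inE//; exact: measurableI.
    apply: (le_trans (bad_le ji' Ux)); rewrite lee_wpmul2l//.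
      by rewrite lee_fin invr_ge0 ltW.
    by apply: le_trans mui'; rewrite le_measure ?inE//; exact: subIsetl.
  apply: (@le_trans _ _ (K%:E * ((4 * K * r)^-1%:E * (r%:E * mu j I)))%E).
    by rewrite lee_wpmul2l// lee_fin ltW.
  by rewrite aE -!EFinM lee_fin le_eqVlt; apply/orP; left; apply/eqP; field; rewrite !gt_eqF.
(* On [H] the value [|gp y|] is at least [lam i], so at both levels the two densities add up to
   [Phi y |gp y|]. *)
have gain : (mu i H + G i H <= mu j H + G j H)%E.
  apply: dens_leD => // y cy [[Iy [_ Uy]] nb] /=; rewrite /gw_fun !normlam.
  have gy : lam i <= `|gp y|.
    rewrite leNgt; apply/negP => gy; apply: nb; split => //.
    move: gy; rewrite /gp normrM lamS gtr0_norm ?divr_gt0 ?(lt_trans _ b1)//.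
    rewrite -mulrA ltr_pM2l ?(lt_trans _ b1)// ltr_pdivrMl//.
  have ly : lam j <= lam i by apply: lam_le; exact: ltnW.
  have p1 : Phi y (lam i) <= Phi y `|gp y| by apply: Phi_le => //; exact: ltW.
  have p2 : Phi y (lam j) <= Phi y (lam i) by apply: Phi_le => //; exact: ltW.
  by rewrite !max_l ?subr_ge0//; [lra|exact: le_trans p1].
have fi (A : set R) : mb A -> A `<=` I -> mu i A \is a fin_num.
  by move=> mA AI; exact: (fin_le mA mI AI mui1).
have fj (A : set R) : mb A -> A `<=` I -> mu j A \is a fin_num.
  by move=> mA AI; exact: (fin_le mA mI AI muM).
have fGA k (A : set R) : mb A -> A `<=` I -> G k A \is a fin_num.
  by move=> mA AI; apply: G_fin => //; exact: subset_trans Ic.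
have frho (A : set R) : mb A -> A `<=` circle -> rho A \is a fin_num.
  by move=> mA Ac; exact: (fin_le mA mA (subset_refl _) (rho_le mA Ac)).
have GE : (G i E <= G j E)%E by apply: G_mono => //; exact: ltnW.
have GH : (G i H <= G j H)%E by apply: G_mono => //; exact: ltnW.
have GX : (G j E + G j H <= G j I)%E.
  by rewrite -(splitX (G j)) le_measure ?inE.
have muH : (mu j H <= mu j I)%E by rewrite le_measure ?inE.
have small : (mu i H < c%:E * mu i I)%E -> (mu j H <= (8^-1)%:E * mu j I)%E.
  exact: Hsmall.
have F1f := frho _ (measurableD mIL (mU i)) (fun y h => Ic _ h.1.1).
have F2f := frho _ (measurableI _ _ mIL (mU i)) (fun y h => Ic _ h.1.1).
have sm : (mu i X = mu i E + mu i H)%E := splitX _.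
have sG : (G i X = G i E + G i H)%E := splitX _.
rewrite rhoF; move: F1 F2; rewrite sm sG.
have e1 := fineK (fi _ mE EI); have e2 := fineK (fi _ mH HI).
have e3 := fineK (fGA i _ mE EI); have e4 := fineK (fGA i _ mH HI).
have e5 := fineK (fGA j _ mE EI); have e6 := fineK (fGA j _ mH HI).
have e7 := fineK (fj _ mH HI); have e8 := fineK (fi _ mI (fun y h => h)).
have e9 := fineK fG; have e10 := fineK F1f; have e11 := fineK F2f.
move: muE gain GE GH GX muH small mui muiI.
rewrite aE -e1 -e2 -e3 -e4 -e5 -e6 -e7 -e8 -e9 -e10 -e11.
move: (fine (mu i E)) (fine (mu i H)) (fine (G i E)) (fine (G i H)) (fine (G j E))
  (fine (G j H)) (fine (mu j H)) (fine (mu i I)) (fine (G j I))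
  (fine (rho (I `&` L N `\` U i))) (fine (rho (I `&` L N `&` U i))).
move=> xe xh ge gh ge' gh' xh' xi gi u1 u2.
rewrite -?EFinM -?EFinD -?EFinM -?EFinD !lee_fin !lte_fin.
move=> muE gain GE GH GX muH small mui muiI F1 F2.
(* Either the mass of [H] at least doubles from level [j] to [i], or [small] applies and gives twice
   an eighth of [a]. *)
have D : 2 * xh' <= xh \/ xh <= 4^-1 * a.
  have [hh|hh] := leP (2 * xh') xh; [by left|right].
  have xh8 : xh' <= 8^-1 * a.
    apply: small; apply: (lt_le_trans hh); apply: (@le_trans _ _ (2 * a)).
      by rewrite ler_pM2l.
    by move: muiI; rewrite /r mulrAC ler_pdivrMr// [xi * c]mulrC.
  apply: (le_trans (ltW hh)); apply: (@le_trans _ _ (2 * (8^-1 * a))).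
    by rewrite ler_pM2l.
  by rewrite mulrA; apply: ler_wpM2r => //; lra.
have Ca : C1 * a = 4 * (K * r * a) by rewrite /C1 -!mulrA.
exact: (step_bound (ltW C1_gt0) a0 Ca F1 F2 muE GE GH GX gain D).
Qed.

(** The bound of [piece_bound] from level 0, summed over all pieces of [U 0]; the charge [G 0] is at
    most the modular of [gp]. *)
Lemma level_bound N :
  (rho (U 0 `&` L N) <= C1%:E * mu 0 (U 0) + (2 * C1)%:E * rhog circle)%E.
Proof.
have C0 : 0 <= C1 by exact: ltW.
have C20 : 0 <= 2 * C1 by rewrite mulr_ge0.
apply: (@le_trans _ _ (C1%:E * mu 0 (U 0) + (2 * C1)%:E * G 0 (U 0)))%E.
  have := @dens_pieces_le R C1 (2 * C1) (Phi_weight mf mfm) (level mf (lam 0)) (gw 0)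
    (L N) circle (U 0) C0 C20 (mL N) (@U_circle 0) (@U_open 0) circle_lebR.
  rewrite (setIidr (@U_circle 0)); apply => y Uy _; first exact: piece_circle.
  exact: (@piece_bound N 0).
rewrite leeD2l// lee_wpmul2l ?lee_fin//.
apply: (@le_trans _ _ (rhog (U 0))); last first.
  by rewrite le_measure ?inE//; exact: circle_lebR.
apply: dens_le => // x cx _ /=; rewrite /gw_fun ge_max Phi_ge0// andbT.
by rewrite lerBlDr lerDl Phi_ge0.
Qed.

End good_lambda_step.

(** * Proof of the theorem *)

Section doubling.
Variables (R : realType) (Phi : R -> R -> R).
Hypothesis mf : modular_family Phi.
Variable K : R.
Hypothesis K1 : 1 <= K.
Hypothesis dbl : forall x t, circle x -> 0 <= t -> Phi x (2 * t) <= K * Phi x t.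

Lemma doubling_pow q x t : circle x -> 0 <= t ->
  Phi x (2 ^+ q * t) <= K ^+ q * Phi x t.
Proof.
move=> cx t0; elim: q => [|q IH]; first by rewrite !expr0 !mul1r.
have q0 : 0 <= 2 ^+ q * t by rewrite mulr_ge0// exprn_ge0.
rewrite !exprS -!mulrA (le_trans (dbl cx q0))// ler_wpM2l//.
exact: le_trans K1.
Qed.

Lemma modular_scale q (k : R) (f : R -> R) : circle_measurable f -> `|k| <= 2 ^+ q ->
  (modular Phi (fun x => k * f x)%R <= (K ^+ q)%:E * modular Phi f)%E.
Proof.
move=> mfm kq; rewrite (modularE mf mfm) (modularE mf (circle_measurableZ k mfm)).
apply: dens_leZ; [|exact: circle_lebR|].
  by rewrite exprn_ge0// (le_trans _ K1).
move=> x cx _ /=; apply: le_trans (doubling_pow q cx (normr_ge0 _)).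
by apply: Phi_le => //; rewrite normrM ler_wpM2r.
Qed.

Lemma modular_scale_le1 (k : R) (f : R -> R) : circle_measurable f -> `|k| <= 1 ->
  (modular Phi (fun x => k * f x)%R <= modular Phi f)%E.
Proof.
move=> mfm k1; have := @modular_scale 0 k f mfm; rewrite !expr0 mul1e.
exact.
Qed.

Lemma exp2_ge (y : R) : exists q, y <= 2 ^+ q.
Proof.
have [n yn] : exists n : nat, y < n%:R.
  exists (Num.bound `|y|); apply: le_lt_trans (ler_norm y) _.
  exact: archi_boundP.
exists n; apply: (le_trans (ltW yn)).
by rewrite -natrX ler_nat ltnW// ltn_expl.
Qed.

Lemma modular_scale_fin (k : R) (f : R -> R) : circle_measurable f ->
  (modular Phi f < +oo)%E -> (modular Phi (fun x => k * f x)%R < +oo)%E.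
Proof.
move=> mfm fin; have [q kq] := exp2_ge `|k|.
apply: le_lt_trans (modular_scale mfm kq) _.
by rewrite lte_mul_pinfty// lee_fin exprn_ge0// (le_trans _ K1).
Qed.

Hypothesis ainf : A_infty Phi.
Variable F : set ((R -> R) * (R -> R)).
Hypothesis hF : forall f g : R -> R, F (f, g) ->
     [/\ forall x, circle x -> 0 <= f x,
         circle_lower_semicontinuous f
       & circle_measurable g].
Hypothesis good : good_lambda F.

Let half_cvg0 (z : R) : 2^-1 ^+ n * z @[n --> \oo] --> (0 : R).
Proof.
rewrite -[X in _ --> X](mul0r z); apply: cvgM; last exact: cvg_cst.
by apply: cvg_expr; rewrite ger0_norm//; lra.
Qed.

(* Dominated convergence removes the contribution of the lowest level. *)
Lemma modular_le_limit (f : R -> R) (mfm : circle_measurable f) (C b : R) (D : \bar R) :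
  (forall x, circle x -> 0 <= f x) ->
  (modular Phi f < +oo)%E -> 2 <= b -> 0 <= C -> D \is a fin_num ->
  (forall l N, 0 < l ->
    (dens (Phi_weight mf mfm)
       ([set x | circle x /\ (l < f x)%R] `&` [set x | circle x /\ (f x <= l * b ^+ N)%R])
     <= C%:E * dens (level mf l) [set x | circle x /\ (l < f x)%R] + D)%E) ->
  (modular Phi f <= D)%E.
Proof.
move=> f0 fin b2 C0 Dfin H; pose s n : R := 2^-1 ^+ n.
have s0 n : 0 < s n by rewrite exprn_gt0// invr_gt0.
have s2 n : s n * 2 ^+ n = 1 by rewrite -exprMn mulVf ?expr1n// gt_eqF.
have sS n : s n.+1 <= s n by rewrite /s exprS ler_piMl// ?ltW//; lra.
pose rho := dens (Phi_weight mf mfm).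
(* The set where [f] lies between [2^-n] and [2^n]; these sets exhaust the points where [f] is
   positive. *)
pose B n := [set x | circle x /\ s n < f x] `&` (circle `\` [set x | circle x /\ 2 ^+ n < f x]).
have mB n : measurable (B n : set (lebR R)).
  apply: measurableI; first exact: circle_measurable_gt.
  by apply: measurableD; [exact: circle_lebR|exact: circle_measurable_gt].
have BP n x : B n x <-> [/\ circle x, s n < f x & f x <= 2 ^+ n].
  split; first by move=> [[cx sx] [_ nx]]; split => //; rewrite leNgt; apply/negP => h; apply: nx.
  by move=> [cx sx fx]; split => //; split => // -[_]; rewrite ltNge fx.
have ndB : nondecreasing_seq B.
  apply/nondecreasing_seqP => n; apply/subsetPset => x /BP[cx sx fx]; apply/BP; split => //.
    exact: le_lt_trans sx.
  by rewrite (le_trans fx)// exprS ler_peMl// ?exprn_ge0//; lra.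
have mUB : measurable (\bigcup_n B n : set (lebR R)) by exact: bigcupT_measurable.
have cB : rho (B n) @[n --> \oo] --> rho (\bigcup_n B n).
  exact: (nondecreasing_cvg_mu (mu := rho) mB mUB ndB).
have UB : \bigcup_n B n = [set x | circle x /\ 0 < f x].
  apply/seteqP; split=> x; first by move=> [n _ /BP[cx sx _]]; split => //; exact: lt_trans sx.
  move=> [cx fx]; have [q1 h1] := exp2_ge (f x); have [q2 h2] := exp2_ge (1 + (f x)^-1).
  exists (q1 + q2)%N => //; apply/BP; split => //; last first.
    by rewrite (le_trans h1)// ler_weXn2l ?leq_addr//; lra.
  have h3 : (f x)^-1 < 2 ^+ (q1 + q2).
    apply: (@lt_le_trans _ _ (2 ^+ q2)); last by rewrite ler_weXn2l ?leq_addl//; lra.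
    by apply: lt_le_trans h2; rewrite ltrDr.
  rewrite -(ltr_pM2r (exprn_gt0 (q1 + q2) (ltr0n R 2))) s2.
  by rewrite -(ltr_pM2l fx) divff ?gt_eqF// in h3.
have rhoUB : (modular Phi f <= rho (\bigcup_n B n))%E.
  have cE : circle = (\bigcup_n B n) `|` (circle `\` \bigcup_n B n) :> set R.
    by rewrite setDUK// UB => x [].
  have mC : measurable (circle `\` \bigcup_n B n : set (lebR R)).
    by apply: measurableD => //; exact: circle_lebR.
  rewrite (modularE mf mfm) [in leLHS]cE.
  apply: le_trans (measureU2 rho mUB mC) _.
  have z : (rho (circle `\` \bigcup_n B n) <= 0%:E * rho (circle `\` \bigcup_n B n))%E.
    apply: dens_leZ => // x cx [_]; rewrite UB => nx /=; rewrite mul0r.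
    have -> : f x = 0.
      apply/le_anti; rewrite f0// andbT leNgt; apply/negP => h; exact: nx.
    by rewrite normr0 Phi_0.
  by rewrite mul0e in z; rewrite -[leRHS]adde0 leeD2l.
apply: (le_trans rhoUB).
(* The modular of this truncation dominates the level measure of the set where [f > s n] and tends
   to 0. *)
pose h n x := Num.min (f x) (s n).
have mh n : circle_measurable (h n).
  by apply: measurable_minr => //; exact: measurable_cst.
have h0 n x : circle x -> 0 <= h n x by move=> cx; rewrite le_min f0// ltW.
have ch : modular Phi (h n) @[n --> \oo] --> (0 : \bar R).
  apply: (modular_cvg0 mf mfm mh) => //.
    by move=> n x cx; rewrite !ger0_norm ?h0// ?f0// ge_min lexx.
  move=> x cx; apply: (@squeeze_cvgr _ _ _ _ (fun=> 0) s).
  - by near=> n; rewrite h0//= ge_min lexx orbT.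
  - exact: cvg_cst.
  - by have := half_cvg0 1; under eq_fun do rewrite mulr1.
have cR : (C%:E * modular Phi (h n) + D)%E @[n --> \oo] --> D.
  rewrite -[X in _ --> X]add0e; apply: cvgeD; [by rewrite fin_num_adde_defl| |exact: cvg_cst].
  by rewrite -(mule0 C%:E); exact: cvgeZl.
rewrite -(cvg_lim _ cB)// -(cvg_lim _ cR)//; apply: lee_lim.
- by apply/cvg_ex; eexists; exact: cB.
- by apply/cvg_ex; eexists; exact: cR.
near=> n; have mUn : measurable ([set x | circle x /\ s n < f x] : set (lebR R)).
  exact: circle_measurable_gt.
apply: (@le_trans _ _ (C%:E * dens (level mf (s n)) [set x | circle x /\ (s n < f x)%R] + D)%E).
  (* With [2 * n] steps of ratio [b >= 2], the top level is at least [2^-n * 2^(2n) = 2^n], so [B n]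
     is covered. *)
  apply: le_trans (H (s n) (n + n)%N (s0 n)); rewrite le_measure ?inE//.
    apply: measurableI => //; rewrite (_ : [set x | _] =
        circle `\` [set x | circle x /\ s n * b ^+ (n + n) < f x]).
      by apply: measurableD; [exact: circle_lebR|exact: circle_measurable_gt].
    apply/seteqP; split=> x /= [cx]; first by move=> fx; split => // -[_]; rewrite ltNge fx.
    by move=> nx; split => //; rewrite leNgt; apply/negP => fx; apply: nx.
  move=> x /BP[cx sx fx]; split => //; split => //; apply: (le_trans fx).
  apply: (@le_trans _ _ (s n * 2 ^+ (n + n))); first by rewrite exprD mulrA s2 mul1r.
  by rewrite ler_pM2l// lerXn2r// nnegrE; lra.
rewrite leeD2r// lee_wpmul2l ?lee_fin// (modularE mf (mh n)).
apply: (@le_trans _ _ (dens (Phi_weight mf (mh n)) [set x | circle x /\ (s n < f x)%R])).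
  apply: dens_le => // x cx [_ fx] /=; apply: Phi_le => //.
  by rewrite /h min_r// ltW.
by rewrite le_measure ?inE//; [exact: circle_lebR|move=> x []].
Unshelve. all: by end_near.
Qed.

(** The constants are fixed in the order [b], [c], [r], [th], [delta], [gam], all before the pair is
    introduced; [level_bound] then holds at every starting level and the limit removes the lowest
    one. *)
Lemma modular_le_small : exists M C : R, [/\ 0 < M, 0 < C & forall f g, F (f, g) ->
  (modular Phi f <= M%:E)%E -> (modular Phi g < +oo)%E ->
  (modular Phi f <= C%:E * modular Phi g)%E].
Proof.
have [beta beta0 [delta0 delta00 H]] := good.
(* The level ratio is a power of 2, so that doubling controls one step, and at least [beta], so that
   [f > b * l] implies [f > beta * l]. *)
have [p0 bp0] := exp2_ge beta; pose p := p0.+1; pose b : R := 2 ^+ p.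
have b2 : 2 <= b by rewrite /b /p exprS ler_peMr// exprn_ege1//; lra.
have b1 : 1 < b by lra.
have betab : beta <= b by rewrite (le_trans bp0)// /b /p exprS ler_peMl ?exprn_ge0//; lra.
pose Kb := K ^+ p; have Kb1 : 1 <= Kb by rewrite exprn_ege1.
have dblb x t : circle x -> 0 <= t -> Phi x (b * t) <= Kb * Phi x t.
  exact: doubling_pow.
(* An eighth, because the mass of [H] may still grow by a factor 2 and must end below a quarter. *)
have e80 : 0 < 8^-1 :> R by rewrite invr_gt0.
have [c1 c10 Hc1] := level_small mf ainf e80.
pose c := Num.min c1 2; have c0 : 0 < c by rewrite lt_min c10/=; lra.
have c2 : c <= 2 by rewrite ge_min lexx orbT.
pose r := 2 / c; have r1 : 1 <= r by rewrite /r ler_pdivlMr// mul1r.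
have r0 : 0 < r by exact: lt_le_trans r1.
have Kb0 : 0 < Kb by exact: lt_le_trans Kb1.
have Kr0 : 0 < 4 * Kb * r by apply: mulr_gt0 => //; apply: mulr_gt0.
(* Cancels the growth [r] up to the level below [i] and the doubling [Kb] to level [i], leaving a
   quarter. *)
have eps0 : 0 < (4 * Kb * r)^-1 by rewrite invr_gt0.
have [th th0 Hth] := level_upper mf ainf eps0.
pose delta := Num.min th (delta0 / 2).
have delta_gt0 : 0 < delta by rewrite lt_min th0/=; lra.
have delta_lt : delta < delta0 by rewrite gt_min; apply/orP; right; lra.
have [gam gam0 Hg] := H delta delta_gt0 delta_lt.
have [q bq] := exp2_ge `|b / gam|.
have K0 : 0 < K by rewrite (lt_le_trans _ K1).
(* The first value makes [Kb * r * M] equal to 1; the factor [K ^+ q] is the cost of replacing [g]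
   by [b / gam * g]. *)
exists (Kb * r)^-1, (2 * (4 * Kb * r) * K ^+ q); split.
- by rewrite invr_gt0; apply: mulr_gt0.
- by apply: mulr_gt0; [apply: mulr_gt0|rewrite exprn_gt0].
move=> f g Ffg fM gfin; have [f0 lf mg] := hF Ffg.
have mfm := lsc_measurable lf.
pose gp x := b / gam * g x.
have mgp : circle_measurable gp := circle_measurableZ (b / gam) mg.
have gpfin : (modular Phi gp < +oo)%E by exact: modular_scale_fin.
have gpf : modular Phi gp \is a fin_num.
  by rewrite ge0_fin_numE// (modularE mf mgp).
apply: (@le_trans _ _ ((2 * (4 * Kb * r))%:E * modular Phi gp)%E); last first.
  have -> : (2 * (4 * Kb * r) * K ^+ q)%:E = ((2 * (4 * Kb * r))%:E * (K ^+ q)%:E)%E.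
    by rewrite -EFinM.
  rewrite -muleA; apply: lee_wpmul2l; last exact: modular_scale.
  by rewrite lee_fin mulr_ge0// ltW.
apply: (@modular_le_limit f (lsc_measurable lf) (4 * Kb * r) b) => //.
- by rewrite (le_lt_trans fM)// ltry.
- exact: ltW.
- by rewrite fin_numM.
move=> l N l0; rewrite (modularE mf (circle_measurableZ (b / gam) mg)).
have := @level_bound R Phi mf Kb b Kb1 b1 dblb f g lf f0 mg l gam c (Kb * r)^-1
  l0 gam0 c0 c2 _ _ _ th _ (Hth) _ N.
rewrite expr0 mulr1; apply.
- by rewrite -/r divff// gt_eqF//; apply: mulr_gt0.
- by rewrite -(modularE mf (lsc_measurable lf)).
- by rewrite -(modularE mf (circle_measurableZ (b / gam) mg)).
- move=> j x Ux; set I := piece _ _.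
  have lj : 0 < l * b ^+ j by rewrite mulr_gt0// exprn_gt0//; lra.
  have oU : open [set t | [set x0 | circle x0 /\ l * b ^+ j < f x0] (wrap t)].
    exact: level_open.
  have bI : basic_interval [set x0 | circle x0 /\ l * b ^+ j < f x0] I.
    by apply: piece_basic => // y [].
  have := Hg f g Ffg (l * b ^+ j) I lj bI.
  move=> /ltW hI; apply: (@le_trans _ _ (delta%:E * arclength I)%E); last first.
    by rewrite lee_wpmul2r// lee_fin ge_min lexx.
  apply: le_trans hI; apply: le_outer_measure => y [Iy [cy fy gy]]; split => //.
    by apply: le_lt_trans fy; rewrite exprS (mulrCA l) ler_pM2r.
  exact: le_lt_trans (ler_norm _) gy.
move=> i j x ji Ux mu1 E mE EI h; have [cx _] := Ux.
have lj k : 0 < l * b ^+ k by rewrite mulr_gt0// exprn_gt0//; lra.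
have aI : arclike (piece [set x0 | circle x0 /\ l * b ^+ j < f x0] x).
  by apply: piece_arclike => //; exact: level_open.
apply: (Hc1 _ _ _ (lj j) _ aI mu1 _ mE EI).
  by rewrite ler_pM2l// ler_weXn2l ?(ltnW ji)// ltW.
by apply: (lt_le_trans h); rewrite lee_wpmul2r// lee_fin ge_min lexx.
Qed.

Hypothesis hscale : forall f g : R -> R, F (f, g) -> forall alpha : R, 0 < alpha ->
     F (fun x => alpha * f x, fun x => alpha * g x).

(** If the modular of [f] exceeded [A1], the first [f / 2^k] with modular at most [K * A1] would
    still have modular above [A1], since one doubling costs at most [K]. As [K * A1 <= M],
    [modular_le_small] bounds that modular by [C * (A1 / C) = A1], a contradiction. *)
Lemma modular_small (A : R) : 0 < A -> exists2 B : R, 0 < B & forall f g, F (f, g) ->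
  (modular Phi g <= B%:E)%E -> (modular Phi f < +oo)%E -> (modular Phi f <= A%:E)%E.
Proof.
move=> A0; have [M [C [M0 C0 H]]] := modular_le_small.
have K0 : 0 < K by rewrite (lt_le_trans _ K1).
pose A1 := Num.min A (M / K).
have A10 : 0 < A1 by rewrite lt_min A0 divr_gt0.
have A1M : K * A1 <= M by rewrite mulrC -ler_pdivlMr// ge_min lexx orbT.
exists (A1 / C); first by rewrite divr_gt0.
move=> f g Ffg gB fin; have [f0 lf mg] := hF Ffg; have mfm := lsc_measurable lf.
apply: (@le_trans _ _ A1%:E); last by rewrite lee_fin ge_min lexx.
rewrite leNgt; apply/negP => A1f.
pose fk k x := 2^-1 ^+ k * f x.
have mfk k : circle_measurable (fk k) by exact: circle_measurableZ.
have h01 k : 0 <= (2^-1 : R) ^+ k <= 1.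
  by rewrite exprn_ge0 ?exprn_ile1 ?invr_ge0//; lra.
have cfk : modular Phi (fk k) @[k --> \oo] --> (0 : \bar R).
  apply: (modular_cvg0 mf mfm) => //.
  - move=> n x cx; have /andP[? ?] := h01 n.
    by rewrite normrM ler_piMl// ger0_norm.
  - by move=> x cx; exact: half_cvg0.
have exk : exists k, `[< (modular Phi (fk k) <= (K * A1)%:E)%E >].
  have KA : (0 < (K * A1)%:E :> \bar R)%E by rewrite lte_fin mulr_gt0.
  have /fine_cvgP[[N1 _ HN1] /cvgrPdist_le/(_ _ (mulr_gt0 K0 A10))[N2 _ HN2]] := cfk.
  exists (maxn N1 N2); apply/asboolP.
  have /= h1 := HN1 _ (leq_maxl N1 N2); have /= h2 := HN2 _ (leq_maxr N1 N2).
  rewrite -(fineK h1) lee_fin; move: h2; rewrite sub0r normrN; apply: le_trans.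
  exact: ler_norm.
case: (ex_minnP exk) => k /asboolP kle kmin.
have A1fk : (A1%:E < modular Phi (fk k))%E.
  case: k kle kmin => [|k] kle kmin.
    by rewrite (_ : fk 0%N = f)//; apply/funext => x; rewrite /fk expr0 mul1r.
  rewrite ltNge; apply/negP => h; suff : (k.+1 <= k)%N by rewrite ltnn.
  apply: kmin; apply/asboolP.
  have fkE : fk k = (fun x => 2 * fk k.+1 x).
    by apply/funext => x; rewrite /fk exprS -mulrA mulVKf// gt_eqF.
  have := @modular_scale 1 2 (fk k.+1) (mfk _); rewrite -fkE !expr1 ger0_norm//.
  move=> /(_ (lexx _)) h2; apply: (le_trans h2); rewrite EFinM.
  by rewrite lee_wpmul2l// lee_fin ltW.
have Fk : F (fk k, fun x => 2^-1 ^+ k * g x).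
  by apply: hscale => //; rewrite exprn_gt0// invr_gt0.
have gk : (modular Phi (fun x => 2^-1 ^+ k * g x)%R <= (A1 / C)%:E)%E.
  apply: le_trans gB; apply: modular_scale_le1 => //.
  by have /andP[? ?] := h01 k; rewrite ger0_norm.
have fkM : (modular Phi (fk k) <= M%:E)%E by apply: (le_trans kle); rewrite lee_fin.
have gkfin := le_lt_trans gk (ltry _).
have := H _ _ Fk fkM gkfin; rewrite leNgt => /negP; apply.
apply: le_lt_trans A1fk; apply: (@le_trans _ _ (C%:E * (A1 / C)%:E)%E).
  by rewrite lee_wpmul2l// lee_fin ltW.
by rewrite -EFinM mulrCA divff ?mulr1// gt_eqF.
Qed.

End doubling.

(** * From modulars to modified norms *)

Theorem theorem3p9 (R : realType) (Phi : R -> R -> R)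
    (F : set ((R -> R) * (R -> R))) :
  modular_family Phi ->
  uniformly_doubling Phi ->
  A_infty Phi ->
  (forall f g : R -> R, F (f, g) ->
     [/\ forall x, circle x -> 0 <= f x,
         circle_lower_semicontinuous f
       & circle_measurable g]) ->
  (forall f g : R -> R, F (f, g) -> forall alpha : R, 0 < alpha ->
     F (fun x => alpha * f x, fun x => alpha * g x)) ->
  good_lambda F ->
  forall A : R, 0 < A ->
  exists2 B : R, 0 < B &
  forall f g : R -> R, F (f, g) ->
    ((modular Phi f < +oo)%E ->
       (modified_norm Phi A f <= modified_norm Phi B g)%E) /\
    ((modular Phi g <= B%:E)%E ->
       (modular Phi f <= A%:E)%E \/ modular Phi f = +oo%E).
Proof.
move=> mf [C dblC] ainf hF hscale good A A0.
pose K := Num.max 1 C; have K1 : 1 <= K by rewrite le_max lexx.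
have dbl x t : circle x -> 0 <= t -> Phi x (2 * t) <= K * Phi x t.
  move=> cx t0; apply: le_trans (dblC x t cx t0) _.
  by rewrite ler_wpM2r ?Phi_ge0// le_max lexx orbT.
(* Half of [A] leaves room for the strict inequality in the definition of [modified_norm]. *)
have A20 : 0 < A / 2 by rewrite divr_gt0.
have A2A : A / 2 < A by rewrite ltr_pdivrMr// ltr_pMr// ltr1n.
have [B B0 H] := modular_small mf K1 dbl ainf hF good hscale A20.
exists B => // f g Ffg; have [f0 lf mg] := hF f g Ffg; have mfm := lsc_measurable lf.
split=> [fin|gB]; last first.
  have [->|ne] := eqVneq (modular Phi f) +oo%E; [by right|left].
  apply: le_trans (H f g Ffg gB _) _; last by rewrite lee_fin ltW.
  by rewrite ltey.
have divE (h : R -> R) l : (fun x => h x / l) = (fun x => l^-1 * h x).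
  by apply/funext => x; rewrite mulrC.
(* Every [l] admissible for [g] is admissible for [f], by the modular bound for the pair scaled by
   [l^-1]. *)
apply: le_ereal_inf => _ [l [l0 gl] <-]; exists l => //; split => //.
rewrite divE; rewrite divE in gl.
have l'0 : 0 < l^-1 by rewrite invr_gt0.
apply: (@le_lt_trans _ _ (A / 2)%:E); last by rewrite lte_fin.
apply: H (hscale f g Ffg _ l'0) (ltW gl) _.
exact: (modular_scale_fin mf K1 dbl).
Qed.
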